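(* Let $n\ge 1$, let $\lambda_1,\dots,\lambda_n,\sigma_1,\dots,\sigma_n\in\mathbb C$, and put $\lambda_{n+1}=\sigma_{n+1}=0$. Assume that $\operatorname{Re}(\lambda_k-k+1)>0$ and $\operatorname{Re}(\sigma_k-\lambda_k-n+k)>0$ for $k=1,\dots,n$. Then $$\int_{T\in C_n(\mathbb C)}\prod_{j=1}^n\frac{\det [T]_j^{\lambda_j-\lambda_{j+1}}}{\det(1+[T]_j)^{\sigma_j-\sigma_{j+1}}}\,\det T^{-n}\,dT=\prod_{k=1}^n \pi^{k-1}\,\frac{\Gamma(\lambda_k-k+1)\,\Gamma(\sigma_k-\lambda_k-n+k)}{\Gamma(\sigma_k-n+k)} .$$
   Context: $C_n(\mathbb C)$ is the cone of positive definite complex hermitian $n\times n$ matrices. $[T]_j$ denotes the left upper $j\times j$ block of $T$; $\det[T]_j^{a}$ means $(\det [T]_j)^{a}$ (the determinants are positive). $dT=\prod_k dt_{kk}\prod_{k<m}dp_{km}\,dq_{km}$, where $t_{kk}$ are the diagonal entries of $T$ and $t_{km}=p_{km}+iq_{km}$ ($k<m$) the off-diagonal ones. *)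

(* Defs.v *)
From HB Require Import structures.
From mathcomp Require Import all_boot all_order all_algebra sesquilinear.
From mathcomp Require Import complex.
From mathcomp Require Import all_classical all_reals all_analysis.

Set Implicit Arguments.
Unset Strict Implicit.
Unset Printing Implicit Defensive.

Import Order.TTheory GRing.Theory Num.Theory.
Import numFieldNormedType.Exports.

Local Open Scope classical_set_scope.
Local Open Scope ring_scope.
Local Open Scope complex_scope.
Local Open Scope sesquilinear_scope.

Section lebesgue_tuple.
Variable R : realType.
Local Notation Rn n := (n.-tuple (measurableTypeR R)).

Section succ.
Variables (n : nat) (mu : {sigma_finite_measure set (Rn n) -> \bar R}).

Definition tuple_cons (x : measurableTypeR R * Rn n) : Rn n.+1 :=
  [tuple of x.1 :: x.2].

(* Lebesgue measure on R^(n+1) as the product measure on R * R^n, transported to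
   tuples. *)
Definition lebesgue_tuple_succ : set (Rn n.+1) -> \bar R :=
  pushforward (@lebesgue_measure R \x mu)%E tuple_cons.

Let mtuple_cons : measurable_fun setT tuple_cons.
Proof. exact: measurable_cons. Qed.

Let mtuple_consN (A : set (Rn n.+1)) :
  measurable A -> measurable (tuple_cons @^-1` A).
Proof. by move=> mA; rewrite -[X in measurable X]setTI; exact: mtuple_cons. Qed.

Let succ0 : lebesgue_tuple_succ set0 = 0%E.
Proof. by rewrite /lebesgue_tuple_succ /pushforward preimage_set0 measure0. Qed.

Let succ_ge0 A : (0 <= lebesgue_tuple_succ A)%E.
Proof. exact: measure_ge0. Qed.

Let succ_sigma_additive : semi_sigma_additive lebesgue_tuple_succ.
Proof.
move=> F mF tF mUF; rewrite /lebesgue_tuple_succ /pushforward preimage_bigcup.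
apply: measure_semi_sigma_additive.
- by move=> k; exact: mtuple_consN.
- apply/trivIsetP => /= i j _ _ ij; rewrite -preimage_setI.
  by move/trivIsetP : tF => /(_ _ _ _ _ ij) ->//; rewrite preimage_set0.
- by rewrite -preimage_bigcup; exact: mtuple_consN.
Qed.

HB.instance Definition _ := isMeasure.Build _ _ _ lebesgue_tuple_succ
  succ0 succ_ge0 succ_sigma_additive.

Let succ_sigma_finite : sigma_finite setT lebesgue_tuple_succ.
Proof.
pose split (t : Rn n.+1) := (thead t, [tuple of behead t] : Rn n).
have msplit : measurable_fun setT split.
  apply/measurable_fun_pairP; split; first exact: measurable_tnth.
  exact: measurable_behead.
have splitK : cancel tuple_cons split.
  by case=> x t; congr (_, _); exact: val_inj.
have /sigma_finiteP[F [TF ndF Foo]] := sigma_finiteT (@lebesgue_measure R).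
have /sigma_finiteP[G [TG ndG Goo]] := sigma_finiteT mu.
exists (fun k => split @^-1` (F k `*` G k)).
  rewrite -preimage_bigcup -[LHS](preimage_setT split); congr (_ @^-1` _).
  rewrite -setXTT TF TG predeqE => -[x y]; split.
    move=> [/= [i _ Fix] [j _ Gjy]]; exists (maxn i j) => //; split.
    - by move: x Fix; exact/subsetPset/ndF/leq_maxl.
    - by move: y Gjy; exact/subsetPset/ndG/leq_maxr.
  by move=> [i _ []/= ? ?]; split; exists i.
move=> k; have [mF ?] := Foo k; have [mG ?] := Goo k; split.
  by rewrite -[X in measurable X]setTI; apply: msplit => //; exact: measurableX.
rewrite /lebesgue_tuple_succ /pushforward -comp_preimage.
rewrite (_ : split \o tuple_cons = id); last exact/funext.
by rewrite preimage_id product_measure1E// lte_mul_pinfty// ge0_fin_numE.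
Qed.

HB.instance Definition _ := Measure_isSigmaFinite.Build _ _ _
  lebesgue_tuple_succ succ_sigma_finite.

End succ.

Fixpoint lebesgue_tuple n : {sigma_finite_measure set (Rn n) -> \bar R} :=
  if n is m.+1 then lebesgue_tuple_succ (lebesgue_tuple m)
  else \d_([tuple] : Rn 0).

End lebesgue_tuple.

Section complex_analysis.
Variable R : realType.

Definition cexp (z : R[i]) : R[i] :=
  (expR (complex.Re z))%:C * (cos (complex.Im z) +i* sin (complex.Im z)).

(* a ^ s for a positive real base a; the value for a <= 0 is meaningless. *)
Definition cpow (a : R) (s : R[i]) : R[i] := cexp (s * (ln a)%:C).

Section integral.
Context d (T : measurableType d) (mu : {measure set T -> \bar R}).

Definition cintegrable (D : set T) (f : T -> R[i]) : Prop :=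
  mu.-integrable D (fun x => (complex.Re (f x))%:E) /\
  mu.-integrable D (fun x => (complex.Im (f x))%:E).

Definition cintegral (D : set T) (f : T -> R[i]) : R[i] :=
  (\int[mu]_(x in D) complex.Re (f x)) +i* (\int[mu]_(x in D) complex.Im (f x)).

End integral.

(* Euler's integral, which converges exactly when 0 < Re s; it is not continued
   analytically to the remaining s. *)
Definition cGamma (s : R[i]) : R[i] :=
  cintegral (@lebesgue_measure R) `]0, +oo[
    (fun x : measurableTypeR R => cpow x (s - 1) * (expR (- x))%:C).

End complex_analysis.

Section hermitian_matrices.
Variables (R : realType) (n : nat).

(* The hermitian matrix with real coordinates x, indexed by pairs (k, m):
   t_kk = x_kk and t_km = x_km + i x_mk for k < m.  Under this linear
   identification of R^(n * n) with the hermitian matrices, lebesgue_tuple is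
   dT = \prod_k dt_kk \prod_(k < m) dp_km dq_km. *)
Definition hermitian_of (x : (n * n).-tuple (measurableTypeR R)) : 'M[R[i]]_n :=
  let c k m : R := tnth x (mxvec_index k m) in
  \matrix_(k, m)
    if (k < m)%N then c k m +i* c m k
    else if (m < k)%N then c m k -i* c k m
    else (c k k)%:C.

(* Recall that 0 < z for z : R[i] means that z is real and positive. *)
Definition posdef_cone : set 'M[R[i]]_n :=
  [set T | T \is hermsymmx /\
    forall v : 'cV[R[i]]_n, v != 0 -> 0 < (v ^t Num.conj *m T *m v) 0 0].

(* The j.+1 x j.+1 left upper block: ltn_ord j : j < n is also j.+1 <= n. *)
Definition upper_block (j : 'I_n) (T : 'M[R[i]]_n) : 'M[R[i]]_j.+1 :=
  mxsub (widen_ord (ltn_ord j)) (widen_ord (ltn_ord j)) T.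

(* The parts Re only convert the determinants, which are real on the cone, from
   R[i] to R.  As j : 'I_n starts from 0, the factor j is the one of the block
   of size j.+1. *)
Definition beta_integrand (lam sig : nat -> R[i]) (T : 'M[R[i]]_n) : R[i] :=
  (\prod_(j < n)
     (cpow (complex.Re (\det (upper_block j T))) (lam j.+1 - lam j.+2) /
      cpow (complex.Re (\det (1%:M + upper_block j T))) (sig j.+1 - sig j.+2)))
  * (\det T) ^- n.

End hermitian_matrices.

(* Main.v *)
Require Import Defs.
From HB Require Import structures.
From mathcomp Require Import all_boot all_order all_algebra sesquilinear.
From mathcomp Require Import complex.
From mathcomp Require Import all_classical all_reals all_analysis.
From mathcomp Require Import measurable_realfun gauss_integral.
From mathcomp Require Import ring lra.

Set Implicit Arguments.
Unset Strict Implicit.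
Unset Printing Implicit Defensive.

Import Order.TTheory GRing.Theory Num.Theory.
Import numFieldNormedType.Exports.

Local Open Scope classical_set_scope.
Local Open Scope ring_scope.
Local Open Scope complex_scope.

(** For k < n let s_k = det [T]_(k+1) / det [T]_k and
    r_k = det [1 + T]_(k+1) / det [1 + T]_k be the pivots of T and of 1 + T.  Summation
    by parts turns the integrand into the product over k < n of
    s_k ^ (lam_(k+1) - n) * r_k ^ (- sig_(k+1)) ([beta_integrand_pivots]), and the pivots
    behave like independent variables.

    Indeed, let T be the matrix A bordered by a column v and a corner t.  Then T is
    positive definite if and only if A is and s := t - v^H A^-1 v > 0.  The last pivots of
    T and 1 + T are s and r := 1 + t - v^H (1 + A)^-1 v = 1 + s + v^H Q v, where
    Q := A^-1 - (1 + A)^-1 = ((1 + A) A)^-1 is positive definite.  For fixed A, translate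
    t, then change v linearly so that v^H Q v becomes |w|^2; the Jacobian is
    (det Q)^-1 = det A * det (1 + A), the product of all earlier pivots.  By induction the
    integral of a product of nonnegative functions phi_k (s_k, r_k) over the cone is the
    product over k < n of the integrals, over s > 0 and w in C^k, of
    (s r) ^ (n - k - 1) * phi_k (s, r) with r = 1 + s + |w|^2
    ([integral_pivot_product]).

    Each factor is a Beta integral.  With z = a + b + k, replace Gamma(z) * r ^ (- z) by
    the integral of u ^ (z - 1) * e ^ (- u r) over u > 0 and integrate in the order w
    (a Gaussian), s (a scaling), u: the integral of s ^ (a - 1) * r ^ (- z) is
    pi ^ k * Gamma(a) * Gamma(b) / Gamma(z) ([cintegral_pivot_power]).

    The exponents are complex, while the changes of variables rest on Tonelli's theorem
    for nonnegative functions.  But both sides of these identities are multilinear in the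
    family of the phi_k, and a complex function is a combination of four nonnegative ones;
    so the identities hold for complex families as soon as the factors on the product side
    are integrable ([cintegral_prod]).

    Finally, the division by Gamma(z) needs Gamma(z) <> 0 for Re z > 0 ([cGamma_neq0]).
    As Gamma(z + 1) = z * Gamma(z), a zero at z would give zeros at all z + m.  But for
    X large and y fixed, the weight t ^ (X - 1) * e ^ (- t) concentrates around t = X on a
    relative scale on which t ^ (i y) is almost constant, so that Gamma(X + i y) cannot
    vanish ([cGamma_line_neq0]). *)

(** * Lebesgue measure in real coordinates *)

Section product_sigma_finite.
Context d1 d2 (T1 : measurableType d1) (T2 : measurableType d2) (R : realType).
Variables (m1 : {sigma_finite_measure set T1 -> \bar R}) (m2 : {sigma_finite_measure set T2 -> \bar R}).

Lemma product_sigma_finite : sigma_finite setT (m1 \x m2)%E.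
Proof.
have /sigma_finiteP[F [TF ndF Foo]] := sigma_finiteT m1.
have /sigma_finiteP[G [TG ndG Goo]] := sigma_finiteT m2.
exists (fun k => F k `*` G k) => [|k].
  apply/esym/seteqP; split => // -[x y] _.
  have [i _ Fx] : (\bigcup_k F k) x by rewrite -TF.
  have [j _ Gy] : (\bigcup_k G k) y by rewrite -TG.
  exists (maxn i j) => //; split.
    by move: x Fx; exact/subsetPset/ndF/leq_maxl.
  by move: y Gy; exact/subsetPset/ndG/leq_maxr.
have [mF F_fin] := Foo k; have [mG G_fin] := Goo k.
split; first exact: measurableX.
by rewrite product_measure1E// lte_mul_pinfty// ge0_fin_numE.
Qed.

(** Carrying sigma-finiteness with the product allows it to be nested. *)
Definition prodm : {sigma_finite_measure set (T1 * T2)%type -> \bar R} :=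
  HB.pack_for {sigma_finite_measure set (T1 * T2)%type -> \bar R} (m1 \x m2)%E
  (Measure_isSigmaFinite.Build _ _ _ (m1 \x m2)%E product_sigma_finite).

Lemma prodmE A B : measurable A -> measurable B -> prodm (A `*` B) = (m1 A * m2 B)%E.
Proof. exact: product_measure1E. Qed.

Lemma ge0_tonelli (f : T1 * T2 -> \bar R) : measurable_fun setT f ->
  (forall x, 0 <= f x)%E ->
  (\int[prodm]_z f z = \int[m1]_x \int[m2]_y f (x, y))%E.
Proof. exact: fubini_tonelli1. Qed.

Lemma ge0_tonelli_swap (f : T1 * T2 -> \bar R) : measurable_fun setT f ->
  (forall x, 0 <= f x)%E ->
  (\int[m1]_x \int[m2]_y f (x, y) = \int[m2]_y \int[m1]_x f (x, y))%E.
Proof. exact: fubini_tonelli. Qed.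

End product_sigma_finite.
Arguments ge0_tonelli {d1 d2 T1 T2 R} m1 m2 [f].
Arguments ge0_tonelli_swap {d1 d2 T1 T2 R} m1 m2 [f].

Section projections.
Context d d1 d2 (T : measurableType d) (T1 : measurableType d1) (T2 : measurableType d2).

Lemma measurable_fun_fst (f : T -> T1 * T2) :
  measurable_fun setT f -> measurable_fun setT (fun x => (f x).1).
Proof. exact: measurableT_comp. Qed.

Lemma measurable_fun_snd (f : T -> T1 * T2) :
  measurable_fun setT f -> measurable_fun setT (fun x => (f x).2).
Proof. exact: measurableT_comp. Qed.

End projections.

Ltac mproj := repeat first [exact: measurable_fst | exact: measurable_snd
  | exact: measurable_id | apply: measurable_fun_fst | apply: measurable_fun_snd].

Section affine.
Variable R : realType.
Local Notation lam := (@lebesgue_measure R).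
Local Notation Rm := (measurableTypeR R).

Lemma lebesgue_measure_affine (a b : R) (A : set Rm) : 0 < a -> measurable A ->
  lam A = (a%:E * lam ((fun x : Rm => (a * x + b)%R : Rm) @^-1` A))%E.
Proof.
move=> a0 mA.
have mf : measurable_fun setT (fun x : Rm => a * x + b : Rm).
  by apply: measurable_funD => //; exact: measurable_funM.
pose F := (fun x : Rm => a * x + b : Rm).
pose m' : {measure set Rm -> \bar R} := mscale (NngNum (ltW a0)) (pushforward lam F).
apply: (@lebesgue_measure_unique _ (m' mf)) => // X [[x y] _ <-] /=.
rewrite /m' /= /mscale/= /pushforward/=.
have -> : (fun x : Rm => (a * x + b)%R : Rm) @^-1` `]x, y]%classic =
   `](x - b) / a, (y - b) / a]%classic.
  apply/seteqP; split => z /=; rewrite !in_itv/= ler_pdivlMr// ltr_pdivrMr// ltrBlDr lerBrDr (mulrC a)//.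
rewrite !lebesgue_measure_itv/= !lte_fin ltr_pM2r ?invr_gt0// ltrD2r.
case: ifP => _; last by rewrite mule0.
rewrite -!EFinB -EFinM; congr (_%:E).
by field; rewrite gt_eqF.
Qed.

Lemma ge0_integral_affine (a b : R) (f : Rm -> \bar R) : 0 < a ->
  measurable_fun setT f -> (forall x, 0 <= f x)%E ->
  (\int[lam]_x f x = a%:E * \int[lam]_x f (a * x + b)%R)%E.
Proof.
move=> a0 mf f0.
have mF : measurable_fun setT (fun x : Rm => a * x + b : Rm).
  by apply: measurable_funD => //; exact: measurable_funM.
pose F := (fun x : Rm => a * x + b : Rm).
pose m' : {measure set Rm -> \bar R} := mscale (NngNum (ltW a0)) (pushforward lam F).
rewrite (@eq_measure_integral _ _ _ _ (m' mF)); last first.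
  by move=> A mA _; rewrite /m' /= /mscale/= /pushforward/= (lebesgue_measure_affine b a0).
rewrite ge0_integral_mscale//; congr (_ * _)%E.
by rewrite ge0_integral_pushforward.
Qed.

End affine.

Section tuple_measure.
Variable R : realType.
Local Notation lam := (@lebesgue_measure R).
Local Notation Rm := (measurableTypeR R).
Local Notation L := (@lebesgue_tuple R).

Definition box n (A : 'I_n -> set Rm) : set (n.-tuple Rm) :=
  [set t | forall i, A i (tnth t i)].

Lemma measurable_box n (A : 'I_n -> set Rm) : (forall i, measurable (A i)) ->
  measurable (box A).
Proof.
move=> mA; have -> : box A = \bigcap_(i : 'I_n) ((fun t => tnth t i) @^-1` A i).
  by apply/seteqP; split => t /= h; [move=> i _; exact: h|move=> i; exact: h].
apply: fin_bigcap_measurable => // i _.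
rewrite -[X in measurable X]setTI; exact: measurable_tnth.
Qed.

Lemma lebesgue_tuple_box n (A : 'I_n -> set Rm) : (forall i, measurable (A i)) ->
  L n (box A) = (\prod_(i < n) lam (A i))%E.
Proof.
elim: n A => [|n IH] A mA /=.
  rewrite big_ord0 diracE mem_set//=; by move=> [].
rewrite /lebesgue_tuple_succ/= /pushforward big_ord_recl.
have -> : @tuple_cons R n @^-1` box A = A ord0 `*` box (fun i => A (lift ord0 i)).
  apply/seteqP; split => -[x t] /=.
    move=> h; split; first by have := h ord0; rewrite tnth0.
    by move=> i; have := h (lift ord0 i); rewrite tnthS.
  move=> [h0 h] i; have [->|i0] := eqVneq i ord0; first by rewrite tnth0.
  have [j ->] : exists j, i = lift ord0 j.
    case: (unliftP ord0 i) i0 => [j ->|->]; [by exists j|by rewrite eqxx].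
  by rewrite tnthS; exact: h.
rewrite product_measure1E//; last exact: measurable_box.
by rewrite IH.
Qed.

(** The boxes are stable under intersection, generate the sigma-algebra, and cover the
    space by an increasing sequence of boxes of finite measure. *)
Lemma lebesgue_tuple_unique n (m : {measure set (n.-tuple Rm) -> \bar R}) :
  (forall A : 'I_n -> set Rm, (forall i, measurable (A i)) ->
     m (box A) = (\prod_(i < n) lam (A i))%E) ->
  forall B, measurable B -> L n B = m B.
Proof.
move=> mE.
pose G : set (set (n.-tuple Rm)) := [set box A | A in [set A : 'I_n -> set Rm | forall i, measurable (A i)]].
pose g k : set (n.-tuple Rm) := box (fun _ => `[- k%:R, k%:R]%classic : set Rm).
apply: (measure_unique G g).
- suff : g_sigma_preimage (fun i (x : n.-tuple Rm) => tnth x i) = <<s G>> by [].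
  rewrite /g_sigma_preimage; apply/seteqP; split.
    apply: smallest_sub; first exact: smallest_sigma_algebra.
    case: n m mE @G @g => [|n] m mE G g; first by rewrite big_ord0.
    rewrite -bigcup_mkord_ord; apply: bigcup_sub => i Ii _ [B mB <-].
    apply: sub_sigma_algebra; exists (fun j => if j == inord i then B else setT).
      by move=> j; case: ifP.
    apply/seteqP; split => t /=.
      by move=> /(_ (inord i)); rewrite eqxx.
    by move=> [_ Bt] j; case: ifP => // /eqP ->.
  change (<<s G>> `<=` @measurable _ (n.-tuple Rm)).
  apply: smallest_sub; first exact: sigma_algebra_measurable.
  by move=> _ [A mA <-]; exact: measurable_box.
- move=> _ _ [A mA <-] [B mB <-]; exists (fun i => A i `&` B i).
    by move=> i; exact: measurableI.
  apply/seteqP; split => t /=; first by move=> h; split => i; have [] := h i.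
  by move=> [h1 h2] i; split.
- by move=> k; eexists; [|reflexivity].
- apply/seteqP; split => // t _.
  exists (\max_(i < n) (Num.truncn `|tnth t i|).+1)%N => // i /=.
  rewrite in_itv/= -ler_norml.
  apply: le_trans (_ : (Num.truncn `|tnth t i|).+1%:R <= _).
    by apply/ltW; rewrite truncnS_gt.
  by rewrite ler_nat; apply: (@leq_bigmax _ (fun i => (Num.truncn `|tnth t i|).+1)).
- by move=> _ [A mA <-]; rewrite [LHS]lebesgue_tuple_box// mE.
- move=> k; rewrite /g [X in (X < _)%E]lebesgue_tuple_box//.
  suff : (0 <= \prod_(i < n) lam `[(- k%:R)%R, k%:R%R]%classic /\
          \prod_(i < n) lam `[(- k%:R)%R, k%:R%R]%classic < +oo)%E by case.
  apply: (big_ind (fun x : \bar R => 0%E <= x /\ x < +oo)%E).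
  + by split => //; exact: ltry.
  + move=> x y [x0 xy] [y0 yy]; split; first exact: mule_ge0.
    by apply: lte_mul_pinfty => //; rewrite ge0_fin_numE.
  + move=> i _; split; first exact: measure_ge0.
    by rewrite lebesgue_measure_itv/=; case: ifP; rewrite ?ltry// -EFinB ltry.
Qed.

(** By uniqueness, a regrouping th of the coordinates has to be tested on boxes only. *)
Lemma ge0_integral_lebesgue_tuple n d (X : measurableType d) (mu : {measure set X -> \bar R})
    (th : X -> n.-tuple Rm) (f : n.-tuple Rm -> \bar R) :
  measurable_fun setT th ->
  (forall A : 'I_n -> set Rm, (forall i, measurable (A i)) ->
     mu (th @^-1` box A) = (\prod_(i < n) lam (A i))%E) ->
  measurable_fun setT f -> (forall x, 0 <= f x)%E ->
  (\int[L n]_x f x = \int[mu]_x f (th x))%E.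
Proof.
move=> mth thE mf f0.
pose m' : {measure set (n.-tuple Rm) -> \bar R} := pushforward mu th.
rewrite (@eq_measure_integral _ _ _ _ (m' mth)); last first.
  by move=> A mA _; apply: lebesgue_tuple_unique => // B mB; exact: thE.
by rewrite ge0_integral_pushforward.
Qed.

Lemma mxvec_index_bij m n :
  bijective (fun ij : 'I_m * 'I_n => mxvec_index ij.1 ij.2 : 'I_(m * n)).
Proof.
have [g gK Kg] := curry_mxvec_bij m n; exists g => [[i j]|k].
  by rewrite -[RHS]gK ?inE.
by rewrite -[RHS]Kg ?inE//; case: (g k).
Qed.

(** The coordinates of a hermitian matrix of size n + 1, collected from those of its left
    upper block, of its last column (real and imaginary parts) and of its corner.  In the
    array of coordinates the real parts lie above the diagonal, the imaginary parts below. *)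
Definition border_coord n (x : (n * n).-tuple Rm * ((n.-tuple Rm * n.-tuple Rm) * Rm)) :
    ((n + 1) * (n + 1)).-tuple Rm :=
  [tuple mxvec (block_mx (vec_mx (\row_k tnth x.1 k)) (\col_i tnth x.2.1.1 i)
     (\row_i tnth x.2.1.2 i) (x.2.2)%:M : 'M[R]_(n + 1)) 0 k | k < (n + 1) * (n + 1)].

Lemma tnth_border_coord n x i j :
  tnth (@border_coord n x) (mxvec_index i j) =
   block_mx (vec_mx (\row_k tnth x.1 k)) (\col_i tnth x.2.1.1 i)
     (\row_i tnth x.2.1.2 i) (x.2.2)%:M i j.
Proof. by rewrite tnth_mktuple mxvecE. Qed.

Lemma measurable_border_coord n : measurable_fun setT (@border_coord n).
Proof.
apply/measurable_fun_tnthP => k.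
case/mxvec_indexP: k => i j.
rewrite (_ : _ \o _ = fun x => block_mx (vec_mx (\row_k tnth x.1 k)) (\col_i tnth x.2.1.1 i)
     (\row_i tnth x.2.1.2 i) (x.2.2)%:M i j); last first.
  by apply/funext => x; rewrite /= tnth_border_coord.
case: (split_ordP i) => i' ->; case: (split_ordP j) => j' ->.
- under eq_fun do rewrite block_mxEul mxE mxE.
  by apply: measurableT_comp (measurable_tnth _) _.
- under eq_fun do rewrite block_mxEur mxE.
  apply: measurableT_comp (measurable_tnth _) _.
  mproj.
- under eq_fun do rewrite block_mxEdl mxE.
  apply: measurableT_comp (measurable_tnth _) _.
  mproj.
- rewrite (ord1 i') (ord1 j'); under eq_fun do rewrite block_mxEdr mxE eqxx mulr1n.
  mproj.
Qed.

(** Bordering permutes the coordinates: the preimage of a box is a product of boxes with the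
    same edges. *)
Lemma border_coord_box n (A : 'I_((n + 1) * (n + 1)) -> set Rm) :
  (forall i, measurable (A i)) ->
  prodm (L (n * n)) (prodm (prodm (L n) (L n)) lam) (@border_coord n @^-1` box A) =
  (\prod_(i < (n + 1) * (n + 1)) lam (A i))%E.
Proof.
move=> mA.
pose B i j := A (mxvec_index i j).
pose ur : 'I_(n + 1) := rshift n ord0.
have [k1 k1K k1I] : bijective (fun ij => mxvec_index ij.1 ij.2 : 'I_(n * n)).
  exact: mxvec_index_bij.
pose C k := B (lshift 1 (k1 k).1) (lshift 1 (k1 k).2).
have -> : @border_coord n @^-1` box A =
   box C `*` ((box (fun i => B (lshift 1 i) ur) `*` box (fun i => B ur (lshift 1 i))) `*` B ur ur).
  apply/seteqP; split => -[x [[p q] t]] /=.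
    move=> h; have {}h i j : B i j _ := h (mxvec_index i j).
    split; last split; last 1 first.
    + by have := h ur ur; rewrite tnth_border_coord/= block_mxEdr mxE eqxx.
    + move=> k; have := h (lshift 1 (k1 k).1) (lshift 1 (k1 k).2).
      by rewrite tnth_border_coord/= block_mxEul mxE mxE k1I.
    + split => i.
      * by have := h (lshift 1 i) ur; rewrite tnth_border_coord/= block_mxEur mxE.
      * by have := h ur (lshift 1 i); rewrite tnth_border_coord/= block_mxEdl mxE.
  move=> [hx [[hp hq] ht]] k; case/mxvec_indexP: k => i j.
  rewrite tnth_border_coord/= -/(B i j).
  case: (split_ordP i) => i' ->; case: (split_ordP j) => j' ->.
  - rewrite block_mxEul mxE mxE.
    by have := hx (mxvec_index i' j'); rewrite /C (k1K (i', j')).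
  - by rewrite block_mxEur mxE ord1; exact: hp.
  - by rewrite block_mxEdl mxE ord1; exact: hq.
  - by rewrite block_mxEdr mxE !ord1 eqxx; exact: ht.
have mb m (D : 'I_m -> set Rm) : (forall i, measurable (D i)) -> measurable (box D).
  exact: measurable_box.
have mC : measurable (box C) by apply: mb => k; exact: mA.
have mp : measurable (box (fun i => B (lshift 1 i) ur)) by apply: mb => k; exact: mA.
have mq : measurable (box (fun i => B ur (lshift 1 i))) by apply: mb => k; exact: mA.
have mt : measurable (B ur ur) by exact: mA.
rewrite [LHS]prodmE//; last by apply: measurableX => //; exact: measurableX.
rewrite [X in (_ * X)%E]prodmE//; last exact: measurableX.
rewrite [X in (_ * (X * _))%E]prodmE//.
rewrite !lebesgue_tuple_box//; try by move=> i; exact: mA.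
rewrite [RHS](reindex (fun ij => mxvec_index ij.1 ij.2)); last exact: onW_bij (mxvec_index_bij _ _).
rewrite -(pair_bigA _ (fun i j => lam (B i j))) big_split_ord/= big_ord1.
under [X in (_ = X * _)%E]eq_bigr do rewrite big_split_ord/= big_ord1.
rewrite [X in (_ = _ * X)%E]big_split_ord/= big_ord1 big_split/=.
rewrite -!muleA; congr (_ * _)%E.
rewrite (reindex (fun ij => mxvec_index ij.1 ij.2)); last exact: onW_bij (mxvec_index_bij _ _).
rewrite pair_bigA; apply: eq_bigr => -[i j] _ /=.
by rewrite /C (k1K (i, j)).
Qed.

Lemma ge0_integral_border n (f : ((n + 1) * (n + 1)).-tuple Rm -> \bar R) :
  measurable_fun setT f -> (forall x, 0 <= f x)%E ->
  (\int[L ((n + 1) * (n + 1))]_x f x =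
   \int[L (n * n)]_x \int[prodm (L n) (L n)]_v \int[lam]_t f (border_coord (x, (v, t))))%E.
Proof.
move=> mf f0.
have mfb : measurable_fun setT (f \o @border_coord n).
  exact: measurableT_comp (@measurable_border_coord n).
rewrite (ge0_integral_lebesgue_tuple (@measurable_border_coord n) (@border_coord_box n) mf f0).
rewrite (ge0_tonelli (L (n * n)) (prodm (prodm (L n) (L n)) lam) mfb (fun y => f0 _)).
apply: eq_integral => x _.
exact: (ge0_tonelli (prodm (L n) (L n)) lam (measurable_fun_pair2 x mfb) (fun y => f0 _)).
Qed.

End tuple_measure.

(** * Positive definite hermitian matrices *)

Section posdef.
Local Open Scope sesquilinear_scope.
Variable R : realType.
Local Notation C := R[i].
Local Notation Rm := (measurableTypeR R).
Local Notation "M ^*t" := (M ^t Num.conj) (at level 2).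

Lemma adjM m n p (A : 'M[C]_(m, n)) (B : 'M[C]_(n, p)) : (A *m B) ^*t = B ^*t *m A ^*t.
Proof. by rewrite trmx_mul map_mxM. Qed.

Lemma adjK m n (A : 'M[C]_(m, n)) : (A ^*t) ^*t = A.
Proof. by apply/matrixP => i j; rewrite !mxE conjCK. Qed.

Lemma adj_inv n (A : 'M[C]_n) : (invmx A) ^*t = invmx (A ^*t).
Proof. by rewrite trmx_inv map_invmx. Qed.

Lemma adjD m n (A B : 'M[C]_(m, n)) : (A + B) ^*t = A ^*t + B ^*t.
Proof. by apply/matrixP => i j; rewrite !mxE rmorphD. Qed.

Lemma adjN m n (A : 'M[C]_(m, n)) : (- A) ^*t = - A ^*t.
Proof. by apply/matrixP => i j; rewrite !mxE rmorphN. Qed.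

Lemma adj1 n : (1%:M : 'M[C]_n) ^*t = 1%:M.
Proof. by rewrite trmx1 map_mx1. Qed.

Lemma adj_block m n (A : 'M[C]_m) (B : 'M[C]_(m, n)) (B' : 'M[C]_(n, m)) (D : 'M[C]_n) :
  (block_mx A B B' D) ^*t = block_mx A ^*t B' ^*t B ^*t D ^*t.
Proof. by rewrite tr_block_mx map_block_mx. Qed.

Lemma adj_col m n (u : 'cV[C]_m) (w : 'cV[C]_n) : (col_mx u w) ^*t = row_mx u ^*t w ^*t.
Proof. by rewrite tr_col_mx map_row_mx. Qed.

Definition hform n (Q : 'M[C]_n) (v : 'cV[C]_n) : C := (v ^*t *m Q *m v) 0 0.

Lemma posdefP n (Q : 'M[C]_n) : posdef_cone Q <->
  Q ^*t = Q /\ forall v, v != 0 -> 0 < hform Q v.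
Proof.
split => -[hQ Qv]; split => //; first by move/is_hermitianmxP: hQ; rewrite expr0 scale1r.
by apply/is_hermitianmxP; rewrite expr0 scale1r.
Qed.

Lemma posdef_adj n (Q : 'M[C]_n) : posdef_cone Q -> Q ^*t = Q.
Proof. by case/posdefP. Qed.

Lemma posdef_unit n (Q : 'M[C]_n) : posdef_cone Q -> Q \in unitmx.
Proof.
case/posdefP => _ Q0; rewrite unitmxE unitfE; apply/negP => /det0P[v v0 vQ].
have := Q0 (v ^*t); rewrite /hform adjK vQ mul0mx mxE ltxx => h.
suff : false by [].
apply: h; apply: contra v0 => /eqP v0.
by rewrite -(adjK v) v0 linear0 map_mx0.
Qed.

Lemma hform0 n (Q : 'M[C]_n) : hform Q 0 = 0.
Proof. by rewrite /hform mulmx0 mxE. Qed.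

Lemma posdef_ge0 n (Q : 'M[C]_n) v : posdef_cone Q -> 0 <= hform Q v.
Proof.
case/posdefP => _ Q0; have [->|v0] := eqVneq v 0; first by rewrite hform0.
exact/ltW/Q0.
Qed.

Lemma hformD n (P Q : 'M[C]_n) v : hform (P + Q) v = hform P v + hform Q v.
Proof. by rewrite /hform mulmxDr mulmxDl mxE. Qed.

Lemma hform_congr m n (P : 'M[C]_(m, n)) (Q : 'M[C]_m) v :
  hform (P ^*t *m Q *m P) v = hform Q (P *m v).
Proof. by rewrite /hform adjM !mulmxA. Qed.

Section schur.
Variables (m n : nat) (A : 'M[C]_m) (B : 'M[C]_(m, n)) (D : 'M[C]_n).
Let S := D - B ^*t *m invmx A *m B.

Lemma det_schur : A \in unitmx ->
  \det (block_mx A B B ^*t D) = \det A * \det S.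
Proof.
move=> uA.
have -> : block_mx A B B ^*t D =
    block_mx 1%:M 0 (B ^*t *m invmx A) 1%:M *m block_mx A B 0 S.
  rewrite mulmx_block !mul1mx !mul0mx !addr0 mulmxKV// /S.
  by rewrite addrCA subrr addr0.
by rewrite det_mulmx det_lblock det_ublock !det1 !mul1r.
Qed.

(** Completion of the square in the variable u. *)
Lemma hform_schur (u : 'cV[C]_m) (w : 'cV[C]_n) : A ^*t = A -> A \in unitmx ->
  hform (block_mx A B B ^*t D) (col_mx u w) =
  hform A (u + invmx A *m B *m w) + hform S w.
Proof.
move=> hA uA; rewrite /hform adj_col mul_row_block mul_row_col.
rewrite [in RHS]adjD 2!adjM adj_inv hA /S.
have mxD (X Y : 'M[C]_1) : X 0 0 + Y 0 0 = (X + Y) 0 0 by rewrite mxE.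
rewrite mxD; congr (fun M : 'M[C]_1 => M 0 0).
have -> : (u ^*t + w ^*t *m (B ^*t *m invmx A)) *m A = u ^*t *m A + w ^*t *m B ^*t.
  by rewrite mulmxDl !mulmxA mulmxKV.
rewrite mulmxDr -addrA; congr (_ + _).
rewrite !mulmxA -mulmxDl; congr (_ *m w).
rewrite mulmxDl mulmxDl mulmxK// mulmxDr mulmxN -addrA; congr (_ + _).
by rewrite !mulmxA addrCA subrr addr0.
Qed.

Lemma hform_block0 (u : 'cV[C]_m) :
  hform (block_mx A B B ^*t D) (col_mx u 0) = hform A u.
Proof.
rewrite /hform adj_col mul_row_block mul_row_col mulmx0 addr0.
by rewrite trmx0 map_mx0 mul0mx addr0.
Qed.

(** The two terms of [hform_schur] can be varied independently: take u = - A^-1 B w for the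
    Schur complement and w = 0 for A. *)
Lemma posdef_schur : posdef_cone (block_mx A B B ^*t D) <->
  posdef_cone A /\ posdef_cone S.
Proof.
split => [/posdefP[hM M0]|[pA /posdefP[hS S0]]].
  have pA : posdef_cone A.
    apply/posdefP; split; first by move: hM; rewrite adj_block => /eq_block_mx[].
    move=> u u0; rewrite -hform_block0; apply: M0.
    by apply: contra u0 => /eqP; rewrite -col_mx0 => /eq_col_mx[->].
  split => //; have hA := posdef_adj pA; have uA := posdef_unit pA.
  apply/posdefP; split.
    move: hM; rewrite adj_block => /eq_block_mx[_ _ _ hD].
    by rewrite /S adjD adjN !adjM adjK adj_inv hA hD mulmxA.
  (* the vector u that minimizes the form for given w *)
  move=> w w0; have := @hform_schur (- (invmx A *m B *m w)) w hA uA.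
  rewrite addNr hform0 add0r => <-; apply: M0.
  by apply: contra w0 => /eqP; rewrite -col_mx0 => /eq_col_mx[_ ->].
have hA := posdef_adj pA; have uA := posdef_unit pA.
apply/posdefP; split.
  rewrite adj_block hA adjK; congr block_mx.
  move: hS; rewrite /S adjD adjN !adjM adjK adj_inv hA mulmxA => /(congr1 (+%R^~ (B ^*t *m invmx A *m B))).
  by rewrite !subrK.
move=> v; rewrite -[v]vsubmxK; set u := usubmx v; set w := dsubmx v => uw0.
rewrite hform_schur//; have [w0|w0] := eqVneq w 0.
  rewrite w0 hform0 addr0 mulmx0 addr0; case/posdefP: pA => _; apply.
  by apply: contra uw0 => /eqP ->; rewrite w0 col_mx0.
by rewrite ltr_wpDl ?posdef_ge0// S0.
Qed.

End schur.

Lemma posdef11 (M : 'M[C]_1) : posdef_cone M <-> 0 < M 0 0.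
Proof.
rewrite posdefP; split => [[_ /(_ 1%:M)]|M0].
  by rewrite /hform adj1 mul1mx mulmx1; apply; rewrite oner_eq0.
split; first by apply/matrixP => i j; rewrite !ord1 !mxE; apply/CrealP; exact: gtr0_real.
move=> v v0; rewrite /hform !mxE big_ord1 mxE big_ord1 !mxE mulrAC -normCKC.
rewrite mulr_gt0// exprn_gt0// normr_gt0; apply: contra v0 => /eqP v0.
by apply/eqP/matrixP => i j; rewrite !ord1 v0 mxE.
Qed.

Lemma posdef_det_gt0 n (Q : 'M[C]_n) : posdef_cone Q -> 0 < \det Q.
Proof.
elim: n Q => [Q _|n IH]; first by rewrite det_mx00 ltr01.
rewrite -addn1 => Q pQ.
rewrite -(submxK Q) in pQ *.
have hM := posdef_adj pQ; move: (hM); rewrite adj_block => /eq_block_mx[_ _ hB _].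
move: pQ; rewrite -hB => /posdef_schur[pA pS].
rewrite det_schur ?posdef_unit// mulr_gt0 ?IH//.
by rewrite det_mx11; exact/posdef11.
Qed.

Lemma posdefD n (P Q : 'M[C]_n) : posdef_cone P -> posdef_cone Q -> posdef_cone (P + Q).
Proof.
move=> /posdefP[hP P0] /posdefP[hQ Q0]; apply/posdefP; split.
  by rewrite adjD hP hQ.
by move=> v v0; rewrite hformD addr_gt0 ?P0 ?Q0.
Qed.

Lemma posdef1 n : posdef_cone (1%:M : 'M[C]_n).
Proof.
apply/posdefP; split; first exact: adj1.
move=> v v0; rewrite /hform mulmx1 mxE.
under eq_bigr do rewrite !mxE -normCKC.
have s0 : 0 <= \sum_i `|v i 0| ^+ 2 by apply: sumr_ge0 => i _; exact: exprn_ge0.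
rewrite lt0r s0 andbT; apply: contra v0 => /eqP/psumr_eq0P v0.
apply/eqP/matrixP => i j; rewrite (ord1 j) mxE; apply/eqP.
by rewrite -normr_eq0 -sqrf_eq0 v0// => k _; exact: exprn_ge0.
Qed.

Lemma posdef_congr n (P Q : 'M[C]_n) : P \in unitmx -> posdef_cone Q ->
  posdef_cone (P ^*t *m Q *m P).
Proof.
move=> uP /posdefP[hQ Q0]; apply/posdefP; split.
  by rewrite !adjM adjK hQ mulmxA.
move=> v v0; rewrite hform_congr; apply: Q0; apply: contra v0 => /eqP Pv.
by rewrite -(mulKmx uP v) Pv mulmx0.
Qed.

Lemma posdef_inv n (Q : 'M[C]_n) : posdef_cone Q -> posdef_cone (invmx Q).
Proof.
move=> pQ; have uQ := posdef_unit pQ.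
have uV : invmx Q \in unitmx by rewrite unitmx_inv.
have := posdef_congr uV pQ.
rewrite adj_inv (posdef_adj pQ) (mulVmx uQ) mul1mx => pV; exact: pV.
Qed.

Lemma resolvent_inv n (A : 'M[C]_n) : A \in unitmx -> 1%:M + A \in unitmx ->
  invmx A - invmx (1%:M + A) = invmx ((1%:M + A) *m A).
Proof.
move=> uA u1A; have uP : (1%:M + A) *m A \in unitmx by rewrite unitmx_mul u1A.
apply: (can_inj (mulmxK uP)); rewrite mulVmx// mulmxA mulmxBl mulVmx//.
by rewrite mulmxDr mulmx1 mulVmx// addrK mulVmx.
Qed.

(** The difference of the two inverses is the inverse of A + A^H A. *)
Lemma resolvent_posdef n (A : 'M[C]_n) : posdef_cone A ->
  posdef_cone (invmx A - invmx (1%:M + A)).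
Proof.
move=> pA; have uA := posdef_unit pA.
have p1A := posdefD (posdef1 n) pA.
have u1A := posdef_unit p1A.
suff -> : invmx A - invmx (1%:M + A) = invmx (A + A ^*t *m 1%:M *m A).
  exact (posdef_inv (posdefD pA (posdef_congr uA (posdef1 n)))).
have -> : A + A ^*t *m 1%:M *m A = (1%:M + A) *m A.
  by rewrite mulmx1 (posdef_adj pA) mulmxDl mul1mx.
exact: resolvent_inv.
Qed.

Lemma det_resolvent n (A : 'M[C]_n) : posdef_cone A ->
  \det (invmx A - invmx (1%:M + A)) = (\det A * \det (1%:M + A))^-1.
Proof.
move=> pA; have uA := posdef_unit pA.
have p1A := posdefD (posdef1 n) pA.
have u1A := posdef_unit p1A.
suff -> : invmx A - invmx (1%:M + A) = invmx ((1%:M + A) *m A).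
  by rewrite det_inv det_mulmx mulrC.
exact: resolvent_inv.
Qed.

Definition cvec n (v : n.-tuple Rm * n.-tuple Rm) : 'cV[C]_n :=
  \col_i (tnth v.1 i +i* tnth v.2 i).

Lemma hermitian_border n x v t :
  hermitian_of (@border_coord R n (x, (v, t))) =
  block_mx (hermitian_of x) (cvec v) (cvec v) ^*t (t%:C)%:M.
Proof.
apply/matrixP => i j; rewrite mxE !tnth_border_coord.
case: (split_ordP i) => i' ->; case: (split_ordP j) => j' ->.
- by rewrite !block_mxEul /= !mxE.
- have lt_ij : (lshift 1 i' < rshift n j')%N by exact: (ltn_addr j' (ltn_ord i')).
  by rewrite lt_ij !block_mxEur !block_mxEdl !mxE.
- have lt_ji : (lshift 1 j' < rshift n i')%N by exact: (ltn_addr i' (ltn_ord j')).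
  by rewrite ltnNge (ltnW lt_ji) lt_ji !block_mxEur !block_mxEdl !mxE.
- by rewrite (ord1 i') (ord1 j') ltnn !block_mxEdr !mxE !eqxx.
Qed.

Lemma conjCE (a b : R) : Num.conj (a +i* b) = a -i* b :> C.
Proof. by []. Qed.

Lemma adj_hermitian_of n (x : (n * n).-tuple Rm) : (hermitian_of x) ^*t = hermitian_of x.
Proof.
apply/matrixP => i j; rewrite !mxE.
case: (ltngtP i j) => ij; rewrite //=.
- by rewrite conjCE opprK.
by move/val_inj : ij => ->; rewrite conjCE oppr0.
Qed.

End posdef.

(** * Gaussian elimination in an integral over C^n *)

Section cmeasurable.
Context d (T : measurableType d) (R : realType).
Local Notation C := R[i].
Implicit Types f g : T -> C.

Definition cmeasurable (f : T -> C) : Prop :=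
  measurable_fun setT (fun x => complex.Re (f x)) /\ measurable_fun setT (fun x => complex.Im (f x)).

Lemma cmeasurable_cst c : cmeasurable (fun=> c).
Proof. by split; exact: measurable_cst. Qed.

Lemma cmeasurable_complex (f g : T -> R) : measurable_fun setT f -> measurable_fun setT g ->
  cmeasurable (fun x => f x +i* g x).
Proof. by split. Qed.

Lemma cmeasurableD f g : cmeasurable f -> cmeasurable g -> cmeasurable (fun x => f x + g x).
Proof.
move=> [f1 f2] [g1 g2]; split.
  by under eq_fun do rewrite raddfD/=; exact: measurable_funD.
by under eq_fun do rewrite raddfD/=; exact: measurable_funD.
Qed.

Lemma cmeasurableM f g : cmeasurable f -> cmeasurable g -> cmeasurable (fun x => f x * g x).
Proof.
have mulE (x y : C) : x * y = (complex.Re x * complex.Re y - complex.Im x * complex.Im y)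
    +i* (complex.Re x * complex.Im y + complex.Im x * complex.Re y).
  by case: x y => [a b] [c e].
move=> [f1 f2] [g1 g2]; under [X in cmeasurable X]eq_fun do rewrite mulE.
by split => /=; [apply: measurable_funB|apply: measurable_funD]; exact: measurable_funM.
Qed.

Lemma cmeasurable_sum (I : Type) (r : seq I) (F : I -> T -> C) :
  (forall i, cmeasurable (F i)) -> cmeasurable (fun x => \sum_(i <- r) F i x).
Proof.
move=> mF; elim: r => [|i r IH].
  by under eq_fun do rewrite big_nil; exact: cmeasurable_cst.
by under eq_fun do rewrite big_cons; exact: cmeasurableD.
Qed.

Lemma cmeasurable_prod (I : Type) (r : seq I) (F : I -> T -> C) :
  (forall i, cmeasurable (F i)) -> cmeasurable (fun x => \prod_(i <- r) F i x).
Proof.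
move=> mF; elim: r => [|i r IH].
  by under eq_fun do rewrite big_nil; exact: cmeasurable_cst.
by under eq_fun do rewrite big_cons; exact: cmeasurableM.
Qed.

Lemma cmeasurable_det n (M : T -> 'M[C]_n) : (forall i j, cmeasurable (fun x => M x i j)) ->
  cmeasurable (fun x => \det (M x)).
Proof.
move=> mM; apply: cmeasurable_sum => s; apply: cmeasurableM; first exact: cmeasurable_cst.
exact: cmeasurable_prod.
Qed.

End cmeasurable.

Lemma measurable_fun_integral d1 d2 (T1 : measurableType d1) (T2 : measurableType d2) (R : realType)
  (m : {sigma_finite_measure set T2 -> \bar R}) (f : T1 * T2 -> \bar R) :
  measurable_fun setT f -> (forall x, 0 <= f x)%E ->
  measurable_fun setT (fun x => \int[m]_y f (x, y))%E.
Proof. exact: measurable_fun_fubini_tonelli_F. Qed.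

Lemma measurable_fun_integral_swap d1 d2 (T1 : measurableType d1) (T2 : measurableType d2) (R : realType)
  (m : {sigma_finite_measure set T1 -> \bar R}) (f : T1 * T2 -> \bar R) :
  measurable_fun setT f -> (forall x, 0 <= f x)%E ->
  measurable_fun setT (fun y => \int[m]_x f (x, y))%E.
Proof. exact: measurable_fun_fubini_tonelli_G. Qed.

Section complex_space.
Local Open Scope sesquilinear_scope.
Variable R : realType.
Local Notation C := R[i].
Local Notation lam := (@lebesgue_measure R).
Local Notation Rm := (measurableTypeR R).
Local Notation L := (@lebesgue_tuple R).
Local Notation Cn n := (n.-tuple Rm * n.-tuple Rm)%type.
Local Notation mC n := (prodm (L n) (L n)).
Local Notation mC1 := (prodm lam lam).

Definition ccons n (z : Rm * Rm) (w : Cn n) : Cn n.+1 :=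
  (tuple_cons (z.1, w.1), tuple_cons (z.2, w.2)).

Lemma measurable_tuple_cons n : measurable_fun setT (@tuple_cons R n).
Proof. by apply: measurable_cons; mproj. Qed.

Lemma measurable_ccons n d (T : measurableType d) (f : T -> Rm * Rm) (g : T -> Cn n) :
  measurable_fun setT f -> measurable_fun setT g ->
  measurable_fun setT (fun x => ccons (f x) (g x)).
Proof.
move=> mf mg; apply: measurable_fun_pair.
  by apply: (measurableT_comp (@measurable_tuple_cons n)); apply: measurable_fun_pair; mproj.
by apply: (measurableT_comp (@measurable_tuple_cons n)); apply: measurable_fun_pair; mproj.
Qed.

Lemma ge0_integral_tuple_cons n (f : n.+1.-tuple Rm -> \bar R) :
  measurable_fun setT f -> (forall x, 0 <= f x)%E ->
  (\int[L n.+1]_x f x = \int[lam]_x \int[L n]_p f (tuple_cons (x, p)))%E.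
Proof.
move=> mf f0.
have mfc := measurableT_comp mf (@measurable_tuple_cons n).
transitivity (\int[prodm lam (L n)]_z f (tuple_cons z))%E; last first.
  exact: (ge0_tonelli lam (L n) mfc (fun=> f0 _)).
exact: (ge0_integral_pushforward (@measurable_tuple_cons n) _ measurableT mf (fun y _ => f0 y)).
Qed.

Lemma ge0_integral_ccons n (f : Cn n.+1 -> \bar R) :
  measurable_fun setT f -> (forall x, 0 <= f x)%E ->
  (\int[mC n.+1]_v f v = \int[mC1]_z \int[mC n]_w f (ccons z w))%E.
Proof.
move=> mf f0.
have mfz : measurable_fun setT (fun zw : (Rm * Rm) * Cn n => f (ccons zw.1 zw.2)).
  by apply: (measurableT_comp mf); apply: measurable_ccons; mproj.
rewrite (ge0_tonelli (L n.+1) (L n.+1) mf f0).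
rewrite (ge0_integral_tuple_cons (measurable_fun_integral _ mf f0)); last first.
  by move=> x; apply: integral_ge0 => y _; exact: f0.
have mz := measurable_fun_integral (mC n) mfz (fun=> f0 _).
rewrite (ge0_tonelli lam lam mz); last first.
  by move=> x; apply: integral_ge0 => y _; exact: f0.
apply: eq_integral => x _.
transitivity (\int[L n]_p \int[lam]_y \int[L n]_q f (ccons (x, y) (p, q)))%E.
  apply: eq_integral => p _; rewrite ge0_integral_tuple_cons//.
  exact: (measurable_fun_pair2 _ mf).
have mh : measurable_fun setT (fun pyq : (n.-tuple Rm * Rm) * n.-tuple Rm =>
    f (ccons (x, pyq.1.2) (pyq.1.1, pyq.2))).
  apply: (measurableT_comp mf); apply: measurable_ccons; apply: measurable_fun_pair; try exact: measurable_cst; mproj.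
rewrite (ge0_tonelli_swap (L n) lam (measurable_fun_integral (L n) mh (fun=> f0 _))); last first.
  by move=> z; apply: integral_ge0 => y _; exact: f0.
apply: eq_integral => y _.
have mw := measurable_fun_pair2 (x, y) mfz.
by rewrite (ge0_tonelli (L n) (L n) mw (fun=> f0 _)).
Qed.

Lemma ge0_integral_affine2 (a b c : R) (f : Rm * Rm -> \bar R) : 0 < a ->
  measurable_fun setT f -> (forall x, 0 <= f x)%E ->
  (\int[mC1]_z f z = (a ^+ 2)%:E * \int[mC1]_z f (a * z.1 + b, a * z.2 + c)%R)%E.
Proof.
move=> a0 mf f0.
have maff (e : R) : measurable_fun setT (fun x : Rm => a * x + e : Rm).
  by apply: measurable_funD => //; exact: measurable_funM.
have mg : measurable_fun setT (fun z : Rm * Rm => f ((a * z.1 + b)%R, (a * z.2 + c)%R)).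
  apply: (measurableT_comp mf); apply: measurable_fun_pair.
    by apply: (measurableT_comp (maff b)); mproj.
  by apply: (measurableT_comp (maff c)); mproj.
rewrite (ge0_tonelli lam lam mf f0) (ge0_tonelli lam lam mg (fun=> f0 _)) /=.
have mF := measurable_fun_integral lam mf f0.
have F0 x : (0 <= \int[lam]_y f (x, y))%E by apply: integral_ge0 => y _; exact: f0.
rewrite (ge0_integral_affine b a0 mF F0) expr2 EFinM -muleA; congr (_ * _)%E.
rewrite -ge0_integralZl//; last 3 first.
- exact: (measurable_fun_integral lam mg (fun=> f0 _)).
- by move=> x _; apply: integral_ge0 => y _; exact: f0.
- by rewrite lee_fin ltW.
apply: eq_integral => x _.
by rewrite (ge0_integral_affine c a0 (measurable_fun_pair2 (a * x + b : Rm) mf)).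
Qed.

Definition nsq n (v : Cn n) : R := \sum_(i < n) (tnth v.1 i ^+ 2 + tnth v.2 i ^+ 2).

Definition rform n (Q : 'M[C]_n) (v : Cn n) : R := complex.Re (hform Q (cvec v)).

Lemma cmeasurable_cvec n i j : cmeasurable (fun v : Cn n => cvec v i j).
Proof.
under eq_fun do rewrite mxE.
by apply: cmeasurable_complex; apply: measurableT_comp (measurable_tnth i) _; mproj.
Qed.

Lemma cmeasurable_cvec_conj n i j : cmeasurable (fun v : Cn n => Num.conj (cvec v i j)).
Proof.
under eq_fun do rewrite mxE conjCE.
apply: cmeasurable_complex; last apply: measurable_funN.
  by apply: measurableT_comp (measurable_tnth i) _; mproj.
by apply: measurableT_comp (measurable_tnth i) _; mproj.
Qed.

Lemma measurable_rform n (Q : 'M[C]_n) : measurable_fun setT (rform Q).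
Proof.
have [] // : cmeasurable (fun v : Cn n => hform Q (cvec v)).
rewrite /hform; under [X in cmeasurable X]eq_fun do rewrite mxE.
apply: cmeasurable_sum => i; apply: cmeasurableM; last exact: cmeasurable_cvec.
under [X in cmeasurable X]eq_fun do rewrite mxE.
apply: cmeasurable_sum => j; apply: cmeasurableM; last exact: cmeasurable_cst.
under [X in cmeasurable X]eq_fun do rewrite mxE mxE.
exact: cmeasurable_cvec_conj.
Qed.

Lemma measurable_nsq n : measurable_fun setT (@nsq n).
Proof.
apply: measurable_sum => i; apply: measurable_funD; apply: measurable_funX;
  by apply: measurableT_comp (measurable_tnth i) _; mproj.
Qed.

Lemma nsq_ccons n z (w : Cn n) : nsq (ccons z w) = z.1 ^+ 2 + z.2 ^+ 2 + nsq w.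
Proof.
rewrite /nsq big_ord_recl !tnth0; congr (_ + _).
by apply: eq_bigr => i _; rewrite !tnthS.
Qed.

Lemma cvec_ccons n z (w : Cn n) :
  cvec (ccons z w) = col_mx (z.1 +i* z.2)%:M (cvec w) :> 'cV[C]_(1 + n).
Proof.
apply/matrixP => i j; rewrite (ord1 j) mxE.
case: (split_ordP i) => k ->.
  rewrite col_mxEu (ord1 k) mxE eqxx mulr1n.
  have -> : (lshift n (ord0 : 'I_1) : 'I_(1 + n)) = (ord0 : 'I_n.+1) by exact: val_inj.
  by rewrite !tnth0.
rewrite col_mxEd mxE.
have -> : (rshift 1 k : 'I_(1 + n)) = (lift ord0 k : 'I_n.+1) by exact: val_inj.
by rewrite !tnthS.
Qed.

Lemma hform11 (M : 'M[C]_1) (u : 'cV[C]_1) :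
  hform M u = Num.conj (u 0 0) * M 0 0 * u 0 0.
Proof. by rewrite /hform mxE big_ord1 mxE big_ord1 !mxE. Qed.

(** Completion of the square in the first coordinate: S is a Schur complement of Q, and the
    shifts al, be are the real and imaginary parts of a linear form. *)
Lemma rform_head n (Q : 'M[C]_(1 + n)) : posdef_cone Q ->
  exists q S al be, [/\ 0 < q, posdef_cone S, complex.Re (\det Q) = q * complex.Re (\det S) &
    forall z w, rform Q (ccons z w) =
      q * ((z.1 + al w) ^+ 2 + (z.2 + be w) ^+ 2) + rform S w].
Proof.
move=> pQ; have pQ' := pQ; rewrite -(submxK Q) in pQ.
have hM := posdef_adj pQ; move: (hM); rewrite adj_block => /eq_block_mx[_ _ hB _].
set A := ulsubmx Q in pQ hM hB; set B := ursubmx Q in pQ hM hB; set D := drsubmx Q in pQ hM hB.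
rewrite -hB in pQ.
have /posdef_schur[pA pS] := pQ.
have uA := posdef_unit pA; have hA := posdef_adj pA.
have a0 : 0 < A 0 0 by exact/posdef11.
have aE : A 0 0 = (complex.Re (A 0 0))%:C by rewrite RRe_real// gtr0_real.
have q0 : 0 < complex.Re (A 0 0) by move: a0; rewrite aE ltcR.
exists (complex.Re (A 0 0)), (D - B ^t Num.conj *m invmx A *m B),
  (fun w => complex.Re ((invmx A *m B *m cvec w) 0 0)), (fun w => complex.Im ((invmx A *m B *m cvec w) 0 0)).
split => // [|z w].
  rewrite -[in LHS](submxK Q) -hB det_schur// det_mx11 aE.
  by case: (\det _) => x y /=; rewrite mul0r subr0.
rewrite /rform cvec_ccons -[in LHS](submxK Q) -hB hform_schur// raddfD/=; congr (_ + _).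
rewrite -/A -/B hform11 aE; move: (_ *m cvec w) => y.
rewrite !mxE eqxx mulr1n.
case: (y 0 0) => y1 y2; rewrite [Num.conj _]conjCE /=; ring.
Qed.

(** Eliminate the coordinates one after the other.  A coordinate of the complex vector is
    translated by a function of the following ones, which leaves the measure invariant, and
    scaled by the square root of q, which costs q^-1 as it has two real components; the
    numbers q multiply to the determinant. *)
Lemma ge0_integral_rform n (Q : 'M[C]_n) (phi : Rm -> \bar R) : posdef_cone Q ->
  measurable_fun setT phi -> (forall x, 0 <= phi x)%E ->
  (\int[mC n]_v phi (rform Q v) =
   ((complex.Re (\det Q))^-1)%:E * \int[mC n]_v phi (nsq v))%E.
Proof.
elim: n Q phi => [|n IH] Q phi pQ mphi phi0.
  rewrite det_mx00 /= invr1 mul1e; apply: eq_integral => v _.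
  rewrite /rform /nsq big_ord0 /hform.
  by rewrite (_ : cvec v = 0) ?mulmx0 ?mxE//; apply/matrixP => -[].
have [q [S [al [be [q0 pS detQ QE]]]]] := @rform_head n Q pQ.
have s0 : 0 < Num.sqrt q by rewrite sqrtr_gt0.
have mz : measurable_fun setT (fun z : Rm * Rm => z.1 ^+ 2 + z.2 ^+ 2 : Rm).
  by apply: measurable_funD; apply: measurable_funX; mproj.
have mzS : measurable_fun setT (fun zw : (Rm * Rm) * Cn n => phi (zw.1.1 ^+ 2 + zw.1.2 ^+ 2 + rform S zw.2)%R).
  apply: (measurableT_comp mphi); apply: measurable_funD.
    by apply: (measurableT_comp mz); mproj.
  by apply: (measurableT_comp (measurable_rform S)); mproj.
rewrite ge0_integral_ccons//; last exact: (measurableT_comp mphi (measurable_rform Q)).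
rewrite (ge0_tonelli_swap mC1 (mC n) (f := fun zw => phi (rform Q (ccons zw.1 zw.2))))//; last first.
  apply: (measurableT_comp mphi); apply: (measurableT_comp (measurable_rform Q)).
  by apply: measurable_ccons; mproj.
transitivity (\int[mC n]_w ((q^-1)%:E * \int[mC1]_z phi (z.1 ^+ 2 + z.2 ^+ 2 + rform S w)%R))%E.
  apply: eq_integral => w _.
  rewrite (ge0_integral_affine2 (Num.sqrt q * al w) (Num.sqrt q * be w) s0
    (measurable_fun_pair1 w mzS) (fun=> phi0 _)) sqr_sqrtr ?ltW// muleA -EFinM mulVf ?gt_eqF// mul1e.
  apply: eq_integral => z _; rewrite QE /= -!mulrDr !exprMn sqr_sqrtr ?ltW//.
  by rewrite -mulrDr.
rewrite ge0_integralZl//; last 3 first.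
- exact: (measurable_fun_integral_swap mC1 mzS (fun=> phi0 _)).
- by move=> w _; apply: integral_ge0.
- by rewrite lee_fin invr_ge0 ltW.
rewrite -(ge0_tonelli_swap mC1 (mC n) mzS)//=.
rewrite detQ invfM EFinM -muleA; congr (_ * _)%E.
rewrite ge0_integral_ccons//; last exact: (measurableT_comp mphi (@measurable_nsq n.+1)).
rewrite -ge0_integralZl//; last 3 first.
- apply: (measurable_fun_integral (mC n) (f := fun zw : (Rm * Rm) * Cn n => phi (nsq (ccons zw.1 zw.2)))) => //.
  by apply: (measurableT_comp mphi); apply: (measurableT_comp (@measurable_nsq n.+1)); apply: measurable_ccons; mproj.
- by move=> w _; apply: integral_ge0.
- rewrite lee_fin invr_ge0; have := posdef_det_gt0 pS; rewrite ltcE => /andP[_ /ltW]//.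
apply: eq_integral => z _.
rewrite (IH S (fun r => phi (z.1 ^+ 2 + z.2 ^+ 2 + r)%R))//; last first.
  by apply: (measurableT_comp mphi); apply: measurable_funD => //; exact: measurable_cst.
by congr (_ * _)%E; apply: eq_integral => w _; rewrite nsq_ccons.
Qed.

End complex_space.

(** * Leading minors and pivots *)

Section minors.
Local Open Scope sesquilinear_scope.
Variable R : realType.
Local Notation C := R[i].

(** The entry at two natural numbers, extended by 0: leading minors of all orders are then
    functions of a natural number and need no proof of k <= n. *)
Definition nent n (T : 'M[C]_n) (a b : nat) : C :=
  if insub a is Some i then if insub b is Some j then T i j else 0 else 0.

Definition lminor n (T : 'M[C]_n) (j : nat) : R :=
  complex.Re (\det (\matrix_(a < j, b < j) nent T a b)).

Lemma nent_ord n (T : 'M[C]_n) (i j : 'I_n) : nent T i j = T i j.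
Proof. by rewrite /nent !valK. Qed.

Lemma nent_block n (A : 'M[C]_n) B B' D (a b : nat) : (a < n)%N -> (b < n)%N ->
  nent (block_mx A B B' D : 'M[C]_(n + 1)) a b = nent A a b.
Proof.
move=> an bn; have := nent_ord (block_mx A B B' D : 'M[C]_(n + 1)) (lshift 1 (Ordinal an)) (lshift 1 (Ordinal bn)).
by rewrite block_mxEul /= => ->; rewrite -(nent_ord A).
Qed.

Lemma lminor_block n (A : 'M[C]_n) B B' D j : (j <= n)%N ->
  lminor (block_mx A B B' D : 'M[C]_(n + 1)) j = lminor A j.
Proof.
move=> jn; congr (complex.Re (\det _)); apply/matrixP => a b; rewrite !mxE.
by rewrite nent_block// (leq_trans (ltn_ord _)).
Qed.

Lemma lminor_det n (T : 'M[C]_n) : lminor T n = complex.Re (\det T).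
Proof. by congr (complex.Re (\det _)); apply/matrixP => a b; rewrite !mxE nent_ord. Qed.

Lemma lminor_last n (T : 'M[C]_(n + 1)) : lminor T n.+1 = complex.Re (\det T).
Proof. by rewrite -lminor_det; congr (lminor T _); rewrite addn1. Qed.

Lemma lminor0 n (T : 'M[C]_n) : lminor T 0 = 1.
Proof. by rewrite /lminor det_mx00. Qed.

Lemma lminor_upper_block n (T : 'M[C]_n) (j : 'I_n) :
  lminor T j.+1 = complex.Re (\det (upper_block j T)).
Proof.
congr (complex.Re (\det _)); apply/matrixP => a b; rewrite !mxE.
by rewrite -(nent_ord T).
Qed.

(** The quotient for 0 < b, in a form that is measurable in (a, b) on the whole plane. *)
Definition pratio (a b : R) : R := a * b `^ (-1).

Lemma pratioE a b : 0 < b -> pratio a b = a / b.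
Proof. by move=> b0; rewrite /pratio powR_inv1// ltW. Qed.

Lemma pratioMl a x : 0 < a -> pratio (a * x) a = x.
Proof. by move=> a0; rewrite pratioE// mulrAC divff ?mul1r// gt_eqF. Qed.

Definition pivots n (T : 'M[C]_n) (k : nat) : R * R :=
  (pratio (lminor T k.+1) (lminor T k),
   pratio (lminor (1%:M + T) k.+1) (lminor (1%:M + T) k)).

Lemma gt0_complexE (z : C) : 0 < z -> z = (complex.Re z)%:C /\ 0 < complex.Re z.
Proof.
move=> z0; have zE : z = (complex.Re z)%:C by rewrite RRe_real// gtr0_real.
by split => //; rewrite zE ltcR in z0.
Qed.

Section border.
Variables (n : nat) (A : 'M[C]_n) (v : 'cV[C]_n) (t : R).
Let T : 'M[C]_(n + 1) := block_mx A v (v ^t Num.conj) (t%:C)%:M.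
Hypothesis pA : posdef_cone A.

Let s := t - complex.Re (hform (invmx A) v).

Lemma border_complement : ((t%:C)%:M - v ^t Num.conj *m invmx A *m v) 0 0 = s%:C.
Proof.
have h0 := posdef_ge0 v (posdef_inv pA).
have hE : hform (invmx A) v = (complex.Re (hform (invmx A) v))%:C.
  by rewrite RRe_real// ger0_real.
transitivity (t%:C - hform (invmx A) v); last by rewrite hE /s rmorphB.
rewrite /hform; move: (_ *m v) => y.
by rewrite !mxE eqxx mulr1n.
Qed.

Lemma border_posdef : posdef_cone T <-> 0 < s.
Proof.
rewrite posdef_schur posdef11 border_complement ltcR; split => [[]//|s0].
by split.
Qed.

Lemma border_det : complex.Re (\det T) = complex.Re (\det A) * s.
Proof.
have [dA _] := gt0_complexE (posdef_det_gt0 pA).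
by rewrite det_schur ?posdef_unit// det_mx11 border_complement dA /= mulr0 subr0.
Qed.

Lemma border_detP : posdef_cone T <-> 0 < complex.Re (\det T).
Proof.
have [_ dA0] := gt0_complexE (posdef_det_gt0 pA).
by rewrite border_posdef border_det pmulr_rgt0.
Qed.

End border.

Lemma add1_border n (A : 'M[C]_n) v t :
  1%:M + block_mx A v (v ^t Num.conj) (t%:C)%:M =
  block_mx (1%:M + A) v (v ^t Num.conj) ((1 + t)%:C)%:M :> 'M[C]_(n + 1).
Proof.
rewrite (scalar_mx_block n 1 (1 : C)) add_block_mx !add0r; congr block_mx.
by rewrite -raddfD rmorphD.
Qed.

Lemma posdef_add1 n (A : 'M[C]_n) : posdef_cone A -> posdef_cone (1%:M + A).
Proof. exact: posdefD (posdef1 R n). Qed.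

Lemma pivots_border_lt n (A : 'M[C]_n) v t k : (k < n)%N ->
  pivots (block_mx A v (v ^t Num.conj) (t%:C)%:M : 'M[C]_(n + 1)) k = pivots A k.
Proof. by move=> kn; rewrite /pivots add1_border !lminor_block// ltnW. Qed.

Lemma pivots_border n (A : 'M[C]_n) v t : posdef_cone A ->
  pivots (block_mx A v (v ^t Num.conj) (t%:C)%:M : 'M[C]_(n + 1)) n =
  (t - complex.Re (hform (invmx A) v), 1 + t - complex.Re (hform (invmx (1%:M + A)) v)).
Proof.
move=> pA; have p1A := posdef_add1 pA.
have [_ dA0] := gt0_complexE (posdef_det_gt0 pA).
have [_ d1A0] := gt0_complexE (posdef_det_gt0 p1A).
rewrite /pivots add1_border !lminor_last !lminor_block// !lminor_det !border_det//.
by congr pair; [exact: (pratioMl _ dA0)|exact: (pratioMl _ d1A0)].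
Qed.

(** Sylvester's criterion, by bordering. *)
Lemma posdef_minorsP n (T : 'M[C]_n) : T ^t Num.conj = T ->
  posdef_cone T <-> forall k : nat, (k < n)%N -> 0 < lminor T k.+1.
Proof.
elim: n T => [|n IH].
  move=> T hT; split => // _; apply/posdefP; split => // v.
  by rewrite (_ : v = 0) ?eqxx//; apply/matrixP => -[].
rewrite -addn1 => T hT.
have hT' := hT; rewrite -(submxK T) adj_block in hT'.
move/eq_block_mx: hT' => [hA _ hB hD].
have ltE k : (k < n + 1)%N = (k <= n)%N by rewrite addn1.
set A := ulsubmx T in hA; set v := ursubmx T in hB.
have TE : T = block_mx A v (v ^t Num.conj) ((complex.Re (drsubmx T 0 0))%:C)%:M.
  rewrite -[LHS]submxK -hB; congr block_mx.
  rewrite [LHS]mx11_scalar RRe_real//; apply/CrealP.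
  by have /matrixP/(_ 0 0) := hD; rewrite !mxE.
rewrite TE; have {IH} := IH A hA; set t := complex.Re _ => IH.
split => [pT|pos].
  have [pA _] := proj1 (posdef_schur A v _) pT.
  move=> k; rewrite ltE leq_eqVlt => /orP[/eqP ->|kn].
    by rewrite lminor_last; apply/border_detP.
  by rewrite lminor_block//; exact: (proj1 IH pA).
have pA : posdef_cone A.
  by apply/IH => k kn; have := pos k; rewrite lminor_block// ltE ltnW// => /(_ isT).
apply/border_detP => //; rewrite -lminor_last; apply: pos.
by rewrite ltE.
Qed.

Lemma lminor_gt0 n (T : 'M[C]_n) k : posdef_cone T -> (k <= n)%N -> 0 < lminor T k.
Proof.
case: k => [|k]; first by rewrite lminor0 ltr01.
by move=> pT; apply: (proj1 (posdef_minorsP (posdef_adj pT)) pT).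
Qed.

Lemma pivots_gt0 n (T : 'M[C]_n) k : posdef_cone T -> (k < n)%N ->
  0 < (pivots T k).1 /\ 0 < (pivots T k).2.
Proof.
move=> pT kn; have p1T := posdef_add1 pT.
have h M : posdef_cone M -> 0 < pratio (@lminor n M k.+1) (lminor M k).
  by move=> pM; rewrite pratioE ?divr_gt0// lminor_gt0// ltnW.
by split; exact: h.
Qed.

Lemma prod_pratio_lminor n (T : 'M[C]_n) m : posdef_cone T -> (m <= n)%N ->
  \prod_(k < m) pratio (lminor T k.+1) (lminor T k) = lminor T m.
Proof.
move=> pT; elim: m => [|m IH] mn; first by rewrite big_ord0 lminor0.
have m0 := lminor_gt0 pT (ltnW mn).
by rewrite big_ord_recr/= IH 1?ltnW// pratioE// mulrC divfK ?gt_eqF.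
Qed.

Lemma prod_pivots n (T : 'M[C]_n) : posdef_cone T ->
  \prod_(k < n) ((pivots T k).1 * (pivots T k).2) =
  complex.Re (\det T) * complex.Re (\det (1%:M + T)).
Proof.
move=> pT; have p1T := posdef_add1 pT.
rewrite big_split/=.
rewrite -(lminor_det T) -(lminor_det (1%:M + T)); congr (_ * _).
  exact: (prod_pratio_lminor pT (leqnn n)).
exact: (prod_pratio_lminor p1T (leqnn n)).
Qed.

End minors.

(** * Separation of the pivots *)

Section core.
Local Open Scope sesquilinear_scope.
Variable R : realType.
Local Notation C := R[i].
Local Notation lam := (@lebesgue_measure R).
Local Notation Rm := (measurableTypeR R).
Local Notation L := (@lebesgue_tuple R).
Local Notation Cn n := (n.-tuple Rm * n.-tuple Rm)%type.
Local Notation mC n := (prodm (L n) (L n)).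
Local Notation cone n := (@hermitian_of R n @^-1` @posdef_cone R n).

Lemma cmeasurable_hermitian_of n i j :
  cmeasurable (fun x : (n * n).-tuple Rm => hermitian_of x i j).
Proof.
under [X in cmeasurable X]eq_fun do rewrite mxE.
have mt (k : 'I_(n * n)) := @measurable_tnth _ Rm _ k.
case: (i < j)%N; last case: (j < i)%N; apply: cmeasurable_complex;
  by [exact: mt|apply: measurable_funN; exact: mt|exact: measurable_cst].
Qed.

Lemma cmeasurable_hermitian_of1 n i j :
  cmeasurable (fun x : (n * n).-tuple Rm => (1%:M + hermitian_of x) i j).
Proof.
under [X in cmeasurable X]eq_fun do rewrite mxE.
by apply: cmeasurableD; [exact: cmeasurable_cst|exact: cmeasurable_hermitian_of].
Qed.

Lemma measurable_lminor d (X : measurableType d) n (M : X -> 'M[C]_n) k :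
  (forall i j, cmeasurable (fun x => M x i j)) -> measurable_fun setT (fun x => lminor (M x) k).
Proof.
move=> mM; have [] // : cmeasurable (fun x => \det (\matrix_(a < k, b < k) nent (M x) a b)).
apply: cmeasurable_det => i j; under [X in cmeasurable X]eq_fun do rewrite mxE.
rewrite /nent; case: insub => [a|]; last exact: cmeasurable_cst.
by case: insub => [b|]; [exact: mM|exact: cmeasurable_cst].
Qed.

Lemma measurable_pivots n k :
  measurable_fun setT (fun x : (n * n).-tuple Rm => pivots (hermitian_of x) k : Rm * Rm).
Proof.
have mr d (X : measurableType d) (f g : X -> R) : measurable_fun setT f -> measurable_fun setT g ->
    measurable_fun setT (fun x => pratio (f x) (g x)).
  move=> mf mg; apply: measurable_funM => //.
  exact: measurableT_comp (measurable_powR (-1)) mg.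
apply: measurable_fun_pair; apply: mr; apply: measurable_lminor;
  by [exact: cmeasurable_hermitian_of|exact: cmeasurable_hermitian_of1].
Qed.

Lemma measurable_cone n : measurable (cone n).
Proof.
have -> : cone n = \bigcap_(k < n) [set x | 0 < lminor (hermitian_of x) k.+1].
  by apply/seteqP; split => x /=; rewrite posdef_minorsP ?adj_hermitian_of.
apply: bigcap_measurableType => k _.
have := @measurable_lminor _ _ n (@hermitian_of R n) k.+1 (@cmeasurable_hermitian_of n).
move=> /(_ measurableT `]0, +oo[%classic (measurable_itv _)).
by rewrite setTI; congr measurable; apply/seteqP; split => x /=; rewrite in_itv/= andbT.
Qed.

(** The indicator function of the positive half-line. *)
Definition pos (s : R) : R := \1_(`]0, +oo[%classic : set Rm) s.

Lemma measurable_pos : measurable_fun setT (pos : Rm -> Rm).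
Proof. exact: measurable_indic. Qed.

Lemma pos_gt0 s : 0 < s -> pos s = 1.
Proof. by move=> s0; rewrite /pos indicE mem_set//= in_itv/= andbT. Qed.

Lemma pos_le0 s : ~ 0 < s -> pos s = 0.
Proof. by move=> s0; rewrite /pos indicE memNset//= in_itv/= andbT. Qed.

Lemma pos_ge0 s : 0 <= pos s.
Proof. by rewrite /pos indicE. Qed.

(** The variables s and r = 1 + s + |w|^2, which stand for a pair of pivots. *)
Definition pivot_point n (z : Rm * Cn n) : Rm * Rm := (z.1, (1 + z.1 + nsq z.2)%R).

Definition pivot_integral n (psi : Rm * Rm -> R) : \bar R :=
  (\int[prodm lam (mC n)]_z (pos z.1 * psi (pivot_point z))%:E)%E.

Lemma measurable_pivot_point n : measurable_fun setT (@pivot_point n).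
Proof.
apply: measurable_fun_pair; first by mproj.
apply: measurable_funD; first by apply: measurable_funD => //; mproj.
by apply: (measurableT_comp (@measurable_nsq R n)); mproj.
Qed.

Lemma measurable_fun_pivot_integral n psi : measurable_fun setT psi ->
  measurable_fun setT (fun z : Rm * Cn n => (pos z.1 * psi (pivot_point z))%:E).
Proof.
move=> mpsi; apply/measurable_EFinP; apply: measurable_funM.
  by apply: (measurableT_comp measurable_pos); mproj.
exact: measurableT_comp mpsi (@measurable_pivot_point n).
Qed.

Lemma pivot_integral_ge0 n psi : (forall x, 0 <= psi x) -> (0 <= pivot_integral n psi)%E.
Proof. by move=> psi0; apply: integral_ge0 => z _; rewrite lee_fin mulr_ge0 ?pos_ge0. Qed.

(** The translation of t makes s the variable; then r = 1 + s + v^H Q v for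
    Q = A^-1 - (1 + A)^-1, and [ge0_integral_rform] yields the factor (det Q)^-1. *)
Lemma integral_last_pivot n (A : 'M[C]_n) (psi : Rm * Rm -> R) : posdef_cone A ->
  measurable_fun setT psi -> (forall x, 0 <= psi x) ->
  (\int[mC n]_v \int[lam]_t
     (pos (t - rform (invmx A) v) *
      psi (t - rform (invmx A) v, 1 + t - rform (invmx (1%:M + A)) v)%R)%:E =
   (complex.Re (\det A) * complex.Re (\det (1%:M + A)))%:E * pivot_integral n psi)%E.
Proof.
move=> pA mpsi psi0; have p1A := posdef_add1 pA.
pose Q := invmx A - invmx (1%:M + A).
have pQ : posdef_cone Q := resolvent_posdef pA.
have QE v : rform Q v = rform (invmx A) v - rform (invmx (1%:M + A)) v.
  by rewrite /rform /Q /hform mulmxBr mulmxBl !mxE raddfB.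
pose g (vt : Cn n * Rm) : \bar R := (pos vt.2 * psi (vt.2, 1 + vt.2 + rform Q vt.1)%R)%:E.
have mg : measurable_fun setT g.
  apply/measurable_EFinP; apply: measurable_funM.
    by apply: (measurableT_comp measurable_pos); mproj.
  apply: (measurableT_comp mpsi); apply: measurable_fun_pair; first by mproj.
  apply: measurable_funD; first by apply: measurable_funD => //; mproj.
  by apply: (measurableT_comp (measurable_rform Q)); mproj.
have g0 x : (0 <= g x)%E by rewrite lee_fin mulr_ge0 ?pos_ge0.
transitivity (\int[mC n]_v \int[lam]_t g (v, t))%E.
  apply: eq_integral => v _.
  (* t becomes s = t - v^H A^-1 v *)
  rewrite (ge0_integral_affine (- rform (invmx A) v) ltr01 (measurable_fun_pair2 v mg) (fun=> g0 _)) mul1e.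
  apply: eq_integral => t _; rewrite /g /= mul1r QE; congr ((_ * psi (_, _))%:E).
  by rewrite !addrA subrK.
rewrite (ge0_tonelli_swap (mC n) lam mg g0).
have mz := measurable_fun_pivot_integral (n := n) mpsi.
rewrite /pivot_integral (ge0_tonelli lam (mC n) mz) => [|z]; last by rewrite lee_fin mulr_ge0 ?pos_ge0.
have [_ dA0] := gt0_complexE (posdef_det_gt0 pA).
have [_ d1A0] := gt0_complexE (posdef_det_gt0 p1A).
rewrite -ge0_integralZl//; last 3 first.
- apply: (measurable_fun_integral (mC n) mz) => z; by rewrite lee_fin mulr_ge0 ?pos_ge0.
- by move=> t _; apply: integral_ge0 => z _; rewrite lee_fin mulr_ge0 ?pos_ge0.
- by rewrite lee_fin mulr_ge0// ltW.
apply: eq_integral => t _; rewrite /g /=.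
have mphi : measurable_fun setT (fun r : Rm => (pos t * psi (t, 1 + t + r)%R)%:E).
  apply/measurable_EFinP; apply: measurable_funM => //.
  apply: (measurableT_comp mpsi); apply: measurable_fun_pair => //.
  by apply: measurable_funD => //.
rewrite (ge0_integral_rform pQ mphi) => [|r]; last by rewrite lee_fin mulr_ge0 ?pos_ge0.
congr (_%:E * _)%E.
rewrite det_resolvent//.
have [dA _] := gt0_complexE (posdef_det_gt0 pA).
have [d1A _] := gt0_complexE (posdef_det_gt0 p1A).
by rewrite {1}dA {1}d1A -rmorphM -fmorphV /= invrK.
Qed.

Definition pivot_product n (phi : nat -> Rm * Rm -> R) (x : (n * n).-tuple Rm) : R :=
  \1_(cone n) x * \prod_(k < n) phi k (pivots (hermitian_of x) k).

Lemma measurable_pivot_product n (phi : nat -> Rm * Rm -> R) : (forall k, measurable_fun setT (phi k)) ->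
  measurable_fun setT (@pivot_product n phi).
Proof.
move=> mphi; apply: measurable_funM.
  by apply: measurable_indic; exact: measurable_cone.
apply: measurable_prod => k _; apply: (measurableT_comp (mphi k)).
exact: measurable_pivots.
Qed.

Lemma pivot_product_ge0 n phi x : (forall k z, 0 <= phi k z) -> 0 <= @pivot_product n phi x.
Proof. by move=> phi0; rewrite mulr_ge0 ?prodr_ge0// indicE. Qed.

Lemma pivot_product_border n phi x v t :
  @pivot_product (n + 1) phi (border_coord (x, (v, t))) =
  pivot_product phi x *
   (pos (t - rform (invmx (hermitian_of x)) v) *
    phi n (t - rform (invmx (hermitian_of x)) v, 1 + t - rform (invmx (1%:M + hermitian_of x)) v)).
Proof.
rewrite /pivot_product !indicE.
have [pA|nA] := pselect (posdef_cone (hermitian_of x)); last first.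
  rewrite [x \in _]memNset// [_ \in _]memNset ?mul0r//= hermitian_border => /posdef_schur[pA _].
  exact: nA.
rewrite [x \in _]mem_set// mul1r.
have [s0|s0] := pselect (0 < t - rform (invmx (hermitian_of x)) v); last first.
  rewrite (pos_le0 s0) mul0r mulr0 [_ \in _]memNset ?mul0r//= hermitian_border.
  by move/(border_posdef _ _ pA).
rewrite (pos_gt0 s0) mul1r mem_set ?mul1r; last first.
  by rewrite /= hermitian_border; apply/(border_posdef _ _ pA).
have E1 (k : 'I_n) : pivots (hermitian_of (border_coord (x, (v, t)))) k = pivots (hermitian_of x) k.
  by rewrite hermitian_border; exact: pivots_border_lt.
have E2 : pivots (hermitian_of (border_coord (x, (v, t)))) n =
    (t - rform (invmx (hermitian_of x)) v, 1 + t - rform (invmx (1%:M + hermitian_of x)) v).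
  by rewrite hermitian_border; exact: pivots_border.
have split_last (p q : nat -> Rm * Rm) u : (forall k : 'I_n, p k = q k) -> p n = u ->
    \prod_(k < n + 1) phi k (p k) = \prod_(k < n) phi k (q k) * phi n u.
  move=> pq <-; rewrite big_split_ord/= big_ord1 addn0; congr (_ * _).
  by apply: eq_bigr => k _; rewrite pq.
exact: split_last E1 E2.
Qed.

(** Every bordering of a block A multiplies by det A * det (1 + A), which is the product of
    the pivots s_j r_j of A; the factor k meets n - k - 1 borderings.  The absolute value
    makes the weights nonnegative off the cone, too. *)
Lemma integral_pivot_product n (phi : nat -> Rm * Rm -> R) : (forall k, measurable_fun setT (phi k)) ->
  (forall k z, 0 <= phi k z) ->
  (\int[L (n * n)]_x (@pivot_product n phi x)%:E =
   \prod_(k < n) pivot_integral k (fun z => `|z.1 * z.2| ^+ (n - k.+1) * phi k z)%R)%E.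
Proof.
elim: n phi => [|n IH] phi mphi phi0.
  rewrite big_ord0 /= integral_dirac//.
    have c0 : cone 0 ([tuple] : (0 * 0).-tuple Rm).
      apply/posdefP; split; first by apply/matrixP => -[].
      by move=> v; rewrite (_ : v = 0) ?eqxx//; apply/matrixP => -[].
    by rewrite diracE in_setT mul1e /pivot_product big_ord0 mulr1 indicE (mem_set c0).
  by apply/measurable_EFinP; exact: measurable_pivot_product.
rewrite -(addn1 n).
pose J := pivot_integral n (phi n).
have J0 : (0 <= J)%E by exact: pivot_integral_ge0.
(* The Jacobian det A * det (1 + A) of the last step is spread over the earlier factors. *)
pose phi' k (z : Rm * Rm) := `|z.1 * z.2| * phi k z.
have mabs : measurable_fun setT (fun z : Rm * Rm => `|z.1 * z.2| : R).
  by apply: measurableT_comp => //; apply: measurable_funM; mproj.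
have mphi' k : measurable_fun setT (phi' k) by apply: measurable_funM.
have phi'0 k z : 0 <= phi' k z by rewrite mulr_ge0.
rewrite ge0_integral_border; last 2 first.
  by apply/measurable_EFinP; exact: measurable_pivot_product.
  by move=> x; rewrite lee_fin; exact: pivot_product_ge0.
transitivity (\int[L (n * n)]_x ((pivot_product phi' x)%:E * J))%E.
  apply: eq_integral => x _.
  have [pA|nA] := pselect (posdef_cone (hermitian_of x)); last first.
    have E p : @pivot_product n p x = 0 by rewrite /pivot_product indicE memNset// mul0r.
    rewrite E mul0e integral0_eq// => v _; rewrite integral0_eq// => t _.
    by rewrite pivot_product_border E mul0r.
  under eq_integral => v _.
    under eq_integral => t _ do rewrite pivot_product_border EFinM.
    over.
  pose h (vt : Cn n * Rm) : \bar R := (pos (vt.2 - rform (invmx (hermitian_of x)) vt.1) *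
    phi n (vt.2 - rform (invmx (hermitian_of x)) vt.1, 1 + vt.2 - rform (invmx (1%:M + hermitian_of x)) vt.1)%R)%:E.
  have mh : measurable_fun setT h.
    have mr P : measurable_fun setT (fun vt : Cn n * Rm => rform P vt.1 : Rm).
      by apply: (measurableT_comp (measurable_rform P)); mproj.
    apply/measurable_EFinP; apply: measurable_funM.
      apply: (measurableT_comp measurable_pos); apply: measurable_funB; last exact: mr.
      by mproj.
    apply: (measurableT_comp (mphi n)); apply: measurable_fun_pair.
      apply: measurable_funB; last exact: mr.
      by mproj.
    apply: measurable_funB; last exact: mr.
    by apply: measurable_funD; [exact: measurable_cst|mproj].
  have h0 vt : (0 <= h vt)%E by rewrite lee_fin mulr_ge0 ?pos_ge0.
  have pp0 : (0 <= (pivot_product phi x)%:E)%E by rewrite lee_fin; exact: pivot_product_ge0.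
  transitivity (\int[mC n]_v ((pivot_product phi x)%:E * \int[lam]_t h (v, t)))%E.
    apply: eq_integral => v _; rewrite -ge0_integralZl//; exact: (measurable_fun_pair2 v mh).
  rewrite ge0_integralZl//; last 2 first.
  - exact: (measurable_fun_integral lam mh h0).
  - by move=> v _; apply: integral_ge0.
  rewrite integral_last_pivot// muleA -EFinM; congr (_%:E * _)%E.
  rewrite /pivot_product -mulrA; congr (_ * _); rewrite -prod_pivots// -big_split.
  apply: eq_bigr => k _; have [] := pivots_gt0 pA (ltn_ord k).
  move: (pivots (hermitian_of x) k) => z z1 z2.
  by rewrite /phi' (gtr0_norm (mulr_gt0 z1 z2)) [LHS]mulrC.
rewrite ge0_integralZr//; last 2 first.
- by apply/measurable_EFinP; exact: measurable_pivot_product.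
- by move=> x _; rewrite lee_fin; exact: pivot_product_ge0.
rewrite IH// big_split_ord/= big_ord1 addn0 addn1 subnn; congr (_ * _)%E; last first.
  by rewrite /J; congr pivot_integral; apply/funext => z; rewrite expr0 mul1r.
apply: eq_bigr => k _; congr pivot_integral; apply/funext => z.
by rewrite /phi' mulrA -exprSr subSn.
Qed.

End core.

(** * Integrals of complex functions *)

Section cintegral.
Context d (T : measurableType d) (R : realType) (mu : {measure set T -> \bar R}).
Local Notation C := R[i].

Lemma eq_cintegral (D : set T) (f g : T -> C) : {in D, f =1 g} ->
  cintegral mu D f = cintegral mu D g.
Proof.
by move=> fg; congr (_ +i* _); apply: eq_Rintegral => x xD; rewrite fg.
Qed.

Lemma cintegrable_mkcond (D : set T) (f : T -> C) : measurable D ->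
  cintegrable mu D f <-> cintegrable mu setT (fun x => (\1_D x : R)%:C * f x).
Proof.
move=> mD.
have E1 : (fun x => (complex.Re ((\1_D x : R)%:C * f x))%:E) = (fun x => (complex.Re (f x))%:E) \_ D.
  apply/funext => x; rewrite patchE indicE; case: (f x) => a b /=.
  by case: (x \in D); rewrite ?mul1r ?mul0r subr0.
have E2 : (fun x => (complex.Im ((\1_D x : R)%:C * f x))%:E) = (fun x => (complex.Im (f x))%:E) \_ D.
  apply/funext => x; rewrite patchE indicE; case: (f x) => a b /=.
  by case: (x \in D); rewrite ?mul1r ?mul0r addr0.
by rewrite /cintegrable E1 E2 -!integrable_mkcond.
Qed.

Lemma cintegral_mkcond (D : set T) (f : T -> C) :
  cintegral mu D f = cintegral mu setT (fun x => (\1_D x : R)%:C * f x).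
Proof.
rewrite /cintegral 2!(Rintegral_mkcond _ D); congr (_ +i* _); apply: eq_Rintegral => x _;
  by rewrite patchE indicE; case: (f x) => a b /=; case: (x \in D); rewrite ?mul1r ?mul0r ?subr0 ?addr0.
Qed.

Lemma cintegral_sum (I : Type) (r : seq I) (c : I -> C) (g : I -> T -> R) :
  (forall i, mu.-integrable setT (EFin \o g i)) ->
  cintegrable mu setT (fun x => \sum_(i <- r) c i * (g i x)%:C) /\
  cintegral mu setT (fun x => \sum_(i <- r) c i * (g i x)%:C) =
  \sum_(i <- r) c i * (\int[mu]_x g i x)%:C.
Proof.
move=> ig; elim: r => [|i r [[IH1 IH2] IH]].
  under [X in cintegrable _ _ X]eq_fun do rewrite big_nil.
  under [X in cintegral _ _ X]eq_fun do rewrite big_nil.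
  rewrite big_nil; split; first by split; exact: integrable0.
  by rewrite /cintegral /= Rintegral_cst// mul0r.
under [X in cintegrable _ _ X]eq_fun do rewrite big_cons.
under [X in cintegral _ _ X]eq_fun do rewrite big_cons.
have ReE x y : complex.Re (x * (y%:C : C)) = complex.Re x * y by case: x => a b /=; rewrite mulr0 subr0.
have ImE x y : complex.Im (x * (y%:C : C)) = complex.Im x * y by case: x => a b /=; rewrite mulr0 add0r.
have iZ k : mu.-integrable setT (EFin \o (fun x => k * g i x)).
  by have := integrableZl measurableT k (ig i).
split.
  split.
    have := integrableD measurableT (iZ (complex.Re (c i))) IH1.
    by apply: eq_integrable => // x _; rewrite raddfD/= ReE EFinD.
  have := integrableD measurableT (iZ (complex.Im (c i))) IH2.
  by apply: eq_integrable => // x _; rewrite raddfD/= ImE EFinD.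
rewrite big_cons -IH /cintegral.
rewrite (_ : c i * _ = (\int[mu]_x (complex.Re (c i) * g i x)) +i* (\int[mu]_x (complex.Im (c i) * g i x))); last first.
  by rewrite !RintegralZl//; case: (c i) => a b /=; rewrite /GRing.mul/= !mulr0 subr0 add0r.
rewrite /GRing.add/=; congr (_ +i* _).
  by rewrite -RintegralD//; apply: eq_Rintegral => x _; rewrite raddfD/= ReE.
by rewrite -RintegralD//; apply: eq_Rintegral => x _; rewrite raddfD/= ImE.
Qed.

End cintegral.

Section parts.
Variable R : realType.
Local Notation C := R[i].

(** A complex number is the combination of four nonnegative parts with the coefficients
    1, - 1, i and - i: the first component of c selects the imaginary part, the second one
    the sign. *)
Definition part_coef (c : bool * bool) : C := (if c.1 then 'i else 1) * (-1) ^+ c.2.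

Definition part (c : bool * bool) (z : C) : R :=
  Num.max ((-1) ^+ c.2 * (if c.1 then complex.Im z else complex.Re z)) 0.

Lemma part_ge0 c z : 0 <= part c z.
Proof. by rewrite le_max lexx orbT. Qed.

Lemma sum_parts (z : C) : \sum_c part_coef c * (part c z)%:C = z.
Proof.
have pn (x : R) : Num.max x 0 - Num.max (- x) 0 = x.
  have [x0|/ltW x0] := leP 0 x; first by rewrite max_r ?oppr_le0// subr0.
  by rewrite max_l ?oppr_ge0// sub0r opprK.
rewrite -(pair_bigA _ (fun a b => part_coef (a, b) * (part (a, b) z)%:C))/=.
rewrite !big_bool /part_coef /part /= !expr1 !expr0 !mul1r !mulr1 !mulN1r.
have pnC (x : R) : (Num.max x 0)%:C - (Num.max (- x) 0)%:C = x%:C :> C by rewrite -rmorphB/= pn.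
by rewrite mulrN1 mulNr -mulrN -mulrDr ![- _ + _]addrC !pnC addrC -complexE.
Qed.

Lemma partM c (w : R) z : 0 <= w -> part c (w%:C * z) = w * part c z.
Proof.
move=> w0; rewrite /part maxr_pMr// mulr0.
rewrite (_ : (if c.1 then _ else _) = w * (if c.1 then complex.Im z else complex.Re z)); last first.
  by case: c.1; case: z => a b /=; rewrite mul0r ?subr0 ?addr0.
by rewrite mulrCA.
Qed.

Lemma measurable_part d (T : measurableType d) (f : T -> C) c :
  cmeasurable f -> measurable_fun setT (fun x => part c (f x)).
Proof.
move=> [f1 f2]; apply: measurable_maxr => //.
by apply: measurable_funM => //; case: c.1.
Qed.

Lemma integrable_part d (T : measurableType d) (mu : {measure set T -> \bar R}) (f : T -> C) c :
  cintegrable mu setT f -> mu.-integrable setT (EFin \o (fun x => part c (f x))).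
Proof.
move=> [f1 f2].
have h (g : T -> R) (s : bool) : mu.-integrable setT (EFin \o g) ->
    mu.-integrable setT (EFin \o (fun x => Num.max ((-1) ^+ s * g x) 0)).
  move=> ig; apply: (le_integrable measurableT _ _ ig).
    apply/measurable_EFinP; apply: measurable_maxr => //; apply: measurable_funM => //.
    by apply/measurable_EFinP; exact: measurable_int ig.
  move=> x _; rewrite /= lee_fin ger0_norm ?le_max ?lexx ?orbT//.
  rewrite ge_max normr_ge0 andbT (le_trans (ler_norm _))// normrM normrX normrN1 expr1n mul1r//.
by rewrite /part; case: c => -[] s; exact: h.
Qed.

End parts.

Section cintegralZl.
Context d (T : measurableType d) (R : realType) (mu : {measure set T -> \bar R}).
Local Notation C := R[i].

Lemma cintegralZl (c : C) (f : T -> C) : cintegrable mu setT f ->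
  cintegrable mu setT (fun x => c * f x) /\
  cintegral mu setT (fun x => c * f x) = c * cintegral mu setT f.
Proof.
move=> fi.
have fE x : c * f x = \sum_k (c * part_coef R k) * (part k (f x))%:C.
  by rewrite -[f x in LHS]sum_parts mulr_sumr; apply: eq_bigr => k _; rewrite mulrA.
have ip k := integrable_part k fi.
have [i1 e1] := cintegral_sum (index_enum _) (fun k => c * part_coef R k) ip.
have [i2 e2] := cintegral_sum (index_enum _) (part_coef R) ip.
rewrite (funext fE); split=> //; rewrite e1.
rewrite -[f in RHS](_ : (fun x => \sum_k part_coef R k * (part k (f x))%:C) = f); last first.
  by apply/funext => x; exact: sum_parts.
by rewrite e2 mulr_sumr; apply: eq_bigr => k _; rewrite mulrA.
Qed.

End cintegralZl.

Section multilinear.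
Variable R : realType.
Local Notation C := R[i].
Context d (X : measurableType d) (mu : {measure set X -> \bar R}) dy (Y : measurableType dy) n
  dz (Z : 'I_n -> measurableType dz) (nu : forall i, {measure set (Z i) -> \bar R})
  (p : 'I_n -> X -> Y) (q : forall i, Z i -> Y) (K : X -> R) (w : forall i, Z i -> R) (kappa : R).
Hypothesis mp : forall i, measurable_fun setT (p i).
Hypothesis mK : measurable_fun setT K.
Hypothesis K0 : forall x, 0 <= K x.
Hypothesis w0 : forall i (z : Z i), 0 <= w z.
Hypothesis prod_integral : forall phi : 'I_n -> Y -> R,
  (forall i, measurable_fun setT (phi i)) -> (forall i y, 0 <= phi i y) ->
  (\int[mu]_x (K x * \prod_(i < n) phi i (p i x))%:E =
   kappa%:E * \prod_(i < n) \int[nu i]_z (w z * phi i (q z))%:E)%E.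

(** Expand each phi i into its four parts.  Each of the 4 ^ n products is nonnegative, so the
    hypothesis applies to it, and its integral is finite as the parts inherit integrability
    from the factors. *)
Lemma cintegral_prod (phi : 'I_n -> Y -> C) :
  (forall i, cmeasurable (phi i)) ->
  (forall i, cintegrable (nu i) setT (fun z => (w z)%:C * phi i (q z))) ->
  cintegrable mu setT (fun x => (K x)%:C * \prod_(i < n) phi i (p i x)) /\
  cintegral mu setT (fun x => (K x)%:C * \prod_(i < n) phi i (p i x)) =
  kappa%:C * \prod_(i < n) cintegral (nu i) setT (fun z => (w z)%:C * phi i (q z)).
Proof.
move=> mphi iphi.
pose co (f : {ffun 'I_n -> bool * bool}) : C := \prod_(i < n) part_coef R (f i).
pose g (f : {ffun 'I_n -> bool * bool}) x : R := K x * \prod_(i < n) part (f i) (phi i (p i x)).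
pose r i c : R := \int[nu i]_z part c ((w z)%:C * phi i (q z)).
have ipart i c : (nu i).-integrable setT (EFin \o (fun z => part c ((w z)%:C * phi i (q z)))).
  exact: integrable_part.
have rE i c : (\int[nu i]_z (w z * part c (phi i (q z)))%:E = (r i c)%:E)%E.
  rewrite /r /Rintegral fineK; last by apply: integrable_fin_num => //; exact: (ipart i c).
  by apply: eq_integral => z _; rewrite partM.
have gE f : (\int[mu]_x (g f x)%:E = (kappa * \prod_(i < n) r i (f i))%:E)%E.
  rewrite (prod_integral (phi := fun i y => part (f i) (phi i y))); last 2 first.
  - by move=> i; exact: measurable_part.
  - by move=> i y; exact: part_ge0.
  rewrite EFinM; congr (_ * _)%E; under eq_bigr do rewrite rE.
  by rewrite -prodEFin.
have g0 f x : 0 <= g f x by rewrite mulr_ge0// prodr_ge0// => i _; exact: part_ge0.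
have ig f : mu.-integrable setT (EFin \o g f).
  apply/integrableP; split.
    apply/measurable_EFinP; apply: measurable_funM => //; apply: measurable_prod => i _.
    by apply: (measurableT_comp (measurable_part (f i) (mphi i))); exact: mp.
  rewrite (eq_integral (fun x => (g f x)%:E)) ?gE ?ltry// => x _.
  by rewrite gee0_abs ?lee_fin.
have FE x : (K x)%:C * \prod_(i < n) phi i (p i x) = \sum_f co f * (g f x)%:C.
  under eq_bigr do rewrite -[phi _ _]sum_parts.
  rewrite bigA_distr_bigA/= mulr_sumr; apply: eq_bigr => f _.
  by rewrite big_split/= /co /g rmorphM rmorph_prod mulrCA.
have [ci ciE] := cintegral_sum (index_enum {ffun 'I_n -> bool * bool}) co ig.
have FEf : (fun x => (K x)%:C * \prod_(i < n) phi i (p i x)) = (fun x => \sum_f co f * (g f x)%:C).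
  exact/funext.
rewrite FEf; split; first exact: ci.
rewrite ciE.
have nE i : cintegral (nu i) setT (fun z => (w z)%:C * phi i (q z)) = \sum_c part_coef R c * (r i c)%:C.
  have [_ <-] := cintegral_sum (index_enum _) (part_coef R) (ipart i).
  by apply: eq_cintegral => z _; rewrite sum_parts.
under [in RHS]eq_bigr do rewrite nE.
rewrite bigA_distr_bigA/= mulr_sumr; apply: eq_bigr => f _.
have -> : \int[mu]_x g f x = kappa * \prod_(i < n) r i (f i) by rewrite /Rintegral gE.
by rewrite big_split/= rmorphM rmorph_prod mulrCA.
Qed.

End multilinear.

Section cfubini.
Context d1 d2 (T1 : measurableType d1) (T2 : measurableType d2) (R : realType).
Variables (m1 : {sigma_finite_measure set T1 -> \bar R}) (m2 : {sigma_finite_measure set T2 -> \bar R}).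

(** Integrability of every section makes the inner integral finite at every point, so that
    its real value can be integrated again. *)
Lemma Rintegral_fubini (f : T1 * T2 -> R) : (prodm m1 m2).-integrable setT (EFin \o f) ->
  (forall x, m2.-integrable setT (fun y => (f (x, y))%:E)) ->
  m1.-integrable setT (fun x => (\int[m2]_y f (x, y))%:E) /\
  \int[m1]_x \int[m2]_y f (x, y) = \int[prodm m1 m2]_z f z.
Proof.
move=> fi fi2.
have FE : fubini_F m2 (EFin \o f) = (fun x => (\int[m2]_y f (x, y))%:E).
  by apply/funext => x; rewrite /Rintegral fineK//; apply: integrable_fin_num => //; exact: fi2.
split; first by rewrite -FE; exact: integrable_fubini_F.
rewrite /Rintegral; congr fine.
transitivity (\int[m1]_x fubini_F m2 (EFin \o f) x)%E; first by rewrite FE.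
exact: integral12_prod_meas1.
Qed.

Lemma cintegral_fubini (f : T1 * T2 -> R[i]) : cintegrable (prodm m1 m2) setT f ->
  (forall x, cintegrable m2 setT (fun y => f (x, y))) ->
  cintegrable m1 setT (fun x => cintegral m2 setT (fun y => f (x, y))) /\
  cintegral m1 setT (fun x => cintegral m2 setT (fun y => f (x, y))) =
  cintegral (prodm m1 m2) setT f.
Proof.
move=> [f1 f2] fi2.
have [i1 e1] := Rintegral_fubini f1 (fun x => proj1 (fi2 x)).
have [i2 e2] := Rintegral_fubini f2 (fun x => proj2 (fi2 x)).
by split; [split|rewrite /cintegral /= e1 e2].
Qed.

End cfubini.

(** * Euler's integral in the right half-plane *)

Section half_line.
Variable R : realType.
Local Notation lam := (@lebesgue_measure R).
Implicit Types (F f : R -> R) (a l t : R).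

Lemma is_derive_continuous F t d : is_derive t 1 F d -> {for t, continuous F}.
Proof. by move=> dF; apply: differentiable_continuous; apply/derivable1_diffP; exact: ex_derive. Qed.

(** The integrand may be singular at 0: exhaust the half-line by the sets [1 / (i + 1), +oo[
    and pass to the limit by monotone convergence. *)
Lemma ge0_FTC_half_line (f F : R -> R) (l l0 : R) :
  (forall t, 0 < t -> is_derive t 1 F (f t)) -> (forall t, 0 < t -> {for t, continuous f}) ->
  (forall t, 0 < t -> 0 <= f t) ->
  F x @[x --> +oo] --> l -> F x @[x --> 0^'+] --> l0 ->
  (\int[lam]_(x in `]0%R, +oo[) (f x)%:E = (l - l0)%:E)%E.
Proof.
move=> dF cf f0 Fl Fl0.
pose S (i : nat) : set R := `[i.+1%:R^-1, +oo[%classic.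
have S0 i : 0 < i.+1%:R^-1 :> R by rewrite invr_gt0 ltr0n.
have cS i : {within S i, continuous f}.
  apply: continuous_in_subspaceT => x /[!inE]; rewrite /S/= in_itv/= andbT => ix.
  exact/cf/(lt_le_trans (S0 i)).
have intS i : (\int[lam]_(x in S i) (f x)%:E = (l - F i.+1%:R^-1)%:E)%E.
  rewrite (ge0_continuous_FTC2y (F := F) (l := l))//.
  - by move=> x ix; apply/f0/(lt_le_trans (S0 i)).
  - exact: cS.
  - by move=> x ix; apply: ex_derive; apply/dF/(lt_trans (S0 i)).
  - by apply: cvg_at_right_filter; apply: (is_derive_continuous (dF _ (S0 i))).
  - move=> x; rewrite in_itv/= andbT => ix; rewrite derive1E.
    by apply: derive_val; apply/dF/(lt_trans (S0 i)).
have US : \bigcup_i S i = `]0, +oo[%classic.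
  apply/seteqP; split => [x [i _]|x]; rewrite /S/= !in_itv/= !andbT => x0.
    exact: lt_le_trans x0.
  exists (Num.truncn x^-1) => //=; rewrite in_itv/= andbT.
  by rewrite -[leRHS]invrK lef_pV2 ?posrE ?invr_gt0 ?ltr0n// ltW// truncnS_gt.
have SF : nondecreasing_seq S.
  move=> i j ij; apply/subsetPset => x; rewrite /S/= !in_itv/= !andbT; apply: le_trans.
  by rewrite lef_pV2 ?posrE ?ltr0n// ler_nat ltnS.
have := @ge0_nondecreasing_set_cvg_integral _ (measurableTypeR R) R S (EFin \o f) lam SF.
rewrite US => /(_ (fun i => measurable_itv _)) h.
have mf i : measurable_fun (S i) (EFin \o f).
  by apply/measurable_EFinP; apply: subspace_continuous_measurable_fun => //; exact: measurable_itv.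
have fS i x : S i x -> (0%R <= (EFin \o f) x)%E.
  by rewrite /S/= in_itv/= andbT lee_fin => ix; apply/f0/(lt_le_trans (S0 i)).
apply: (cvg_unique _ (h mf fS)); first exact: ereal_hausdorff.
rewrite /= (_ : (fun i => _) = (fun i => (l - F i.+1%:R^-1)%:E)); last by apply/funext => i; rewrite intS.
apply: cvg_EFin; first by apply: nearW.
apply: cvgB; first exact: cvg_cst.
by move/cvg_at_rightP : Fl0; apply; split => //; exact: cvg_harmonic.
Qed.

(** (t / (1 + t)) ^ a, which increases from 0 to 1; its derivative dramp dominates, up
    to a constant, all continuous integrands that are O(t ^ (a - 1)) at 0 and O(t ^ - 2) at infinity. *)
Definition ramp a t := expR (a * (ln t - ln (1 + t))).
Definition dramp a t := a * (t^-1 - (1 + t)^-1) * ramp a t.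

Lemma is_derive_ln1 t : 0 < t -> is_derive t 1 (fun x => ln (1 + x)) (1 + t)^-1.
Proof.
move=> t0.
have h1 : is_derive t 1 (fun x : R => 1 + x) 1.
  by have := is_deriveD (is_derive_cst (1 : R) t 1) (is_derive_id t 1); rewrite add0r.
have h2 : is_derive (1 + t) 1 (@ln R) (1 + t)^-1 by apply: is_derive1_ln; rewrite addr_gt0.
by have := @is_derive1_comp _ (@ln R) (fun x : R => 1 + x) t _ _ h2 h1; rewrite mulr1.
Qed.

Lemma is_derive_ramp a t : 0 < t -> is_derive t 1 (ramp a) (dramp a t).
Proof.
move=> t0.
pose g x : R := a * (ln x - ln (1 + x)).
have h : is_derive t 1 g (a * (t^-1 - (1 + t)^-1)) :=
  is_deriveZ a (is_deriveB (is_derive1_ln t0) (is_derive_ln1 t0)).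
by have := @is_derive1_comp R expR g t _ _ (is_derive_expR (g t)) h; rewrite mulrC.
Qed.

Lemma continuous_dramp a t : 0 < t -> {for t, continuous (dramp a)}.
Proof.
move=> t0; rewrite /dramp.
apply: cvgM; last exact: (is_derive_continuous (is_derive_ramp a t0)).
apply: cvgM; first exact: cvg_cst.
apply: cvgB; apply: cvgV; rewrite ?gt_eqF ?addr_gt0//.
by apply: cvgD => //; exact: cvg_cst.
Qed.

Lemma drampE a t : 0 < t -> dramp a t = a * ramp a t / (t * (1 + t)).
Proof.
move=> t0; rewrite /dramp; have t1 : 1 + t != 0 by rewrite gt_eqF// addr_gt0.
by field; rewrite t1 gt_eqF.
Qed.

Lemma dramp_ge0 a t : 0 <= a -> 0 < t -> 0 <= dramp a t.
Proof.
move=> a0 t0; rewrite drampE// divr_ge0 ?mulr_ge0 ?expR_ge0// ltW//.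
by rewrite addr_gt0.
Qed.

Lemma ramp_le1 a t : 0 <= a -> 0 < t -> ramp a t <= 1.
Proof.
move=> a0 t0; rewrite expR_le1 mulr_ge0_le0// subr_le0 ler_ln ?posrE ?addr_gt0//.
by rewrite lerDr ltW.
Qed.

Lemma cvg_ramp0 a : 0 < a -> ramp a x @[x --> 0^'+] --> (0 : R).
Proof.
move=> a0; apply: (@squeeze_cvgr _ _ _ _ (cst 0) (fun x => x `^ a)); last 2 first.
- exact: cvg_cst.
- exact: powR_cvg0.
near=> x; have x0 : 0 < x by near: x; exact: nbhs_right_gt.
rewrite expR_ge0/= /powR gt_eqF// ler_expR ler_pM2l// gerBl ln_ge0//.
by rewrite lerDl ltW.
Unshelve. all: by end_near. Qed.

Lemma cvg_inv_pinfty : (x : R)^-1 @[x --> +oo] --> (0 : R).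
Proof.
apply/gtr0_cvgV0; last exact: cvg_id.
by near=> x; near: x; exact: nbhs_pinfty_gt.
Unshelve. all: by end_near. Qed.

Lemma cvg_ramp1 a : 0 < a -> ramp a x @[x --> +oo] --> (1 : R).
Proof.
move=> a0; apply: (@squeeze_cvgr _ _ _ _ (fun x => 1 - a * x^-1) (cst 1)); last 2 first.
- have -> : (1 : R) = 1 - a * 0 by rewrite mulr0 subr0.
  apply: cvgB; first by rewrite mulr0 subr0; exact: cvg_cst.
  by apply: cvgM; [exact: cvg_cst|exact: cvg_inv_pinfty].
- exact: cvg_cst.
near=> x; have x0 : 0 < x by near: x; exact: nbhs_pinfty_gt.
rewrite /= (ramp_le1 (ltW a0) x0) andbT (le_trans _ (expR_ge1Dx _))// lerD2l.
rewrite -mulrN ler_pM2l// lerNl opprB -ln_div ?posrE ?addr_gt0//.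
rewrite mulrDl mul1r divff ?gt_eqF// addrC le_ln1Dx//.
by rewrite (lt_trans (ltrN10 _))// invr_gt0.
Unshelve. all: by end_near. Qed.

Lemma integral_dramp a : 0 < a -> (\int[lam]_(x in `]0%R, +oo[) (dramp a x)%:E = 1)%E.
Proof.
move=> a0; have := ge0_FTC_half_line (fun t => @is_derive_ramp a t)
  (fun t => @continuous_dramp a t) (fun t => @dramp_ge0 a t (ltW a0)) (cvg_ramp1 a0) (cvg_ramp0 a0).
by rewrite subr0.
Qed.

Lemma measurable_half_line (f : R -> R) : (forall t, 0 < t -> {for t, continuous f}) ->
  measurable_fun (`]0, +oo[%classic : set R) f.
Proof.
move=> cf; apply: open_continuous_measurable_fun => // x.
by rewrite inE/= in_itv/= andbT; exact: cf.
Qed.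

Lemma integrable_dramp a : 0 < a -> lam.-integrable (`]0, +oo[%classic : set R) (EFin \o dramp a).
Proof.
move=> a0; apply/integrableP; split.
  by apply/measurable_EFinP; apply: measurable_half_line => t; exact: continuous_dramp.
rewrite (eq_integral (fun x : measurableTypeR R => (dramp a x)%:E)) ?integral_dramp ?ltry// => x.
rewrite inE/= in_itv/= andbT => x0.
by rewrite ger0_norm// dramp_ge0// ltW.
Qed.

(** t ^ a * e ^ (- t). *)
Definition gexp a t := expR (a * ln t - t).

Lemma gexpS a t : 0 < t -> gexp (a + 1) t = t * gexp a t.
Proof.
move=> t0; have -> : gexp (a + 1) t = expR (ln t) * gexp a t.
  by rewrite /gexp -expRD; congr expR; ring.
by rewrite lnK ?posrE.
Qed.

(** The claim bounds (1 + t) ^ (a + 2) * e ^ (- t), whose maximum is found from ln u <= u - 1 at u = (1 + t) / (a + 2). *)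
Lemma gexp_le_ramp a : 0 < a -> exists2 M, 0 < M & forall t, 0 < t ->
  gexp a t <= M * ramp a t / (1 + t) ^+ 2.
Proof.
move=> a0; have N0 : 0 < a + 2 by rewrite addr_gt0.
(* the maximum of (1 + t) ^ (a + 2) * e ^ (- t) *)
exists (expR (1 - (a + 2) + (a + 2) * ln (a + 2))); first exact: expR_gt0.
move=> t t0; have t1 : 0 < 1 + t by rewrite addr_gt0.
rewrite ler_pdivlMr ?exprn_gt0//.
rewrite -[1 + t in X in X <= _](@lnK R) ?posrE// -expRM_natl -!expRD ler_expR.
suff : (a + 2) * ln (1 + t) <= t + (1 - (a + 2) + (a + 2) * ln (a + 2)) by lra.
pose u := (1 + t) / (a + 2); have u0 : 0 < u by rewrite divr_gt0.
have tu : 1 + t = (a + 2) * u by rewrite /u mulrC divfK ?gt_eqF.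
have lnu : ln u <= u - 1.
  by have := @le_ln1Dx R (u - 1); rewrite [1 + _]addrC subrK; apply; move: u0; lra.
have : (a + 2) * ln u <= (a + 2) * (u - 1) by rewrite ler_pM2l.
rewrite {1}tu lnM ?posrE//; move: tu; lra.
Qed.

Local Notation Rm := (measurableTypeR R).
Local Notation D := (`]0, +oo[%classic : set Rm).

Let measurable_D : measurable D. Proof. exact: measurable_itv. Qed.

(** The real part of (p - i q) * t ^ (i b). *)
Definition osc b p q t : R := p * cos (b * ln t) + q * sin (b * ln t).

(** The derivative of gexp a * osc b p q. *)
Definition dgosc a b p q t : R :=
  gexp a t * ((a / t - 1) * osc b p q t + b / t * osc b q (- p) t).

Lemma is_derive_osc b p q t : 0 < t ->
  is_derive t 1 (osc b p q) (b / t * osc b q (- p) t).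
Proof.
move=> t0; pose g x : R := b * ln x.
have dg : is_derive t 1 g (b * t^-1) := is_deriveZ b (is_derive1_ln t0).
have dc := @is_derive1_comp R cos g t _ _ (is_derive_cos (g t)) dg.
have ds := @is_derive1_comp R sin g t _ _ (is_derive_sin (g t)) dg.
have := is_deriveD (is_deriveZ p dc) (is_deriveZ q ds).
set d := (X in is_derive _ _ _ X); rewrite (_ : d = b / t * osc b q (- p) t)//.
by rewrite /d /osc /g /GRing.scale/=; ring.
Qed.

Lemma is_derive_gexp a t : 0 < t -> is_derive t 1 (gexp a) (gexp a t * (a / t - 1)).
Proof.
move=> t0; pose g x : R := a * ln x - x.
have dg : is_derive t 1 g (a * t^-1 - 1) :=
  is_deriveB (is_deriveZ a (is_derive1_ln t0)) (is_derive_id t 1).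
exact: (@is_derive1_comp R expR g t _ _ (is_derive_expR (g t)) dg).
Qed.

Lemma is_derive_gosc a b p q t : 0 < t ->
  is_derive t 1 (fun x => gexp a x * osc b p q x) (dgosc a b p q t).
Proof.
move=> t0; have := is_deriveM (is_derive_gexp a t0) (is_derive_osc b p q t0).
set d := (X in is_derive _ _ _ X); rewrite (_ : d = dgosc a b p q t)//.
by rewrite /d /dgosc /GRing.scale/=; ring.
Qed.

Lemma continuous_dgosc a b p q t : 0 < t -> {for t, continuous (dgosc a b p q)}.
Proof.
move=> t0.
have cV : x^-1 @[x --> t] --> t^-1 by apply: cvgV; rewrite ?gt_eqF//; exact: cvg_id.
have cC c : (c : R) @[x --> t] --> c by exact: cvg_cst.
apply: cvgM; first exact: (is_derive_continuous (is_derive_gexp a t0)).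
apply: cvgD; apply: cvgM.
- by apply: cvgB => //; apply: cvgM.
- exact: (is_derive_continuous (is_derive_osc b p q t0)).
- by apply: cvgM.
- exact: (is_derive_continuous (is_derive_osc b q (- p) t0)).
Qed.

Lemma norm_osc_le b p q t : `|osc b p q t| <= `|p| + `|q|.
Proof.
apply: (le_trans (ler_normD _ _)); rewrite !normrM; apply: lerD.
  by rewrite ler_piMr// cos_max.
by rewrite ler_piMr// sin_max.
Qed.

Lemma gexp_gt0 a t : 0 < gexp a t. Proof. exact: expR_gt0. Qed.

Lemma gexp_le_dramp a : 0 < a -> exists2 M, 0 < M & forall t, 0 < t ->
  gexp a t * (1 + t) / t <= M * dramp a t.
Proof.
move=> a0; have [M M0 MP] := gexp_le_ramp a0.
exists (M / a); first exact: divr_gt0.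
move=> t t0; have t1 : 0 < 1 + t by rewrite addr_gt0.
apply: le_trans (_ : M * ramp a t / (1 + t) ^+ 2 * (1 + t) / t <= _).
  by rewrite ler_pM2r ?invr_gt0// ler_pM2r// MP.
rewrite drampE// le_eqVlt; apply/orP; left; apply/eqP.
by field; rewrite !gt_eqF.
Qed.

Lemma le_dgosc a b p q : 0 < a -> exists2 C, 0 <= C & forall t, 0 < t ->
  `|dgosc a b p q t| <= C * dramp a t.
Proof.
move=> a0; have [M M0 MP] := gexp_le_dramp a0.
pose S := `|p| + `|q|; have S0 : 0 <= S by rewrite addr_ge0.
have c0 : 0 <= a + 1 + `|b| by have := normr_ge0 b; move: a0; lra.
exists (S * (a + 1 + `|b|) * M).
  by rewrite mulr_ge0 ?(ltW M0)// mulr_ge0.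
move=> t t0; apply: le_trans (_ : S * (a + 1 + `|b|) * (gexp a t * (1 + t) / t) <= _); last first.
  by rewrite -[leRHS]mulrA; apply: ler_wpM2l; [exact: mulr_ge0|exact: MP].
rewrite /dgosc normrM (gtr0_norm (gexp_gt0 a t)).
have -> : S * (a + 1 + `|b|) * (gexp a t * (1 + t) / t) =
    gexp a t * (S * ((a + 1 + `|b|) * ((1 + t) / t))) by ring.
rewrite ler_pM2l ?gexp_gt0//.
have h1 : `|(a / t - 1) * osc b p q t| <= (a / t + 1) * S.
  rewrite normrM ler_pM// ?norm_osc_le// (le_trans (ler_normB _ _))// normr1 lerD2r.
  by rewrite ger0_norm// divr_ge0// ltW.
have h2 : `|b / t * osc b q (- p) t| <= `|b| / t * S.
  rewrite normrM ler_pM// ?(le_trans (norm_osc_le _ _ _ _))//; last by rewrite normrN addrC.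
  by rewrite normrM normfV (gtr0_norm t0).
apply: (le_trans (ler_normD _ _)); apply: (le_trans (lerD h1 h2)).
have -> : (1 + t) / t = t^-1 + 1 by rewrite mulrDl mul1r divff// gt_eqF.
have b0 := normr_ge0 b; have ti : 0 <= t^-1 by rewrite invr_ge0 ltW.
have h3 : 0 <= S * (a + `|b| + t^-1) by apply: mulr_ge0 => //; move: a0; lra.
by rewrite -subr_ge0 (_ : _ - _ = S * (a + `|b| + t^-1))//; ring.
Qed.

Lemma integrable_dominated (f g : R -> R) C : 0 <= C ->
  (forall t, 0 < t -> {for t, continuous f}) ->
  (forall t, 0 < t -> `|f t| <= C * g t) -> (forall t, 0 < t -> 0 <= g t) ->
  lam.-integrable D (EFin \o g) -> lam.-integrable D (EFin \o f).
Proof.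
move=> C0 cf fg g0 ig.
have iCg : lam.-integrable D (fun t => (C%:E * (EFin \o g) t)%E) := integrableZl measurable_D C ig.
apply: (@le_integrable _ Rm R lam D measurable_D (EFin \o f) _ _ _ iCg).
  by apply/measurable_EFinP; exact: measurable_half_line.
move=> t; rewrite /= in_itv/= andbT => t0; rewrite lee_fin.
by rewrite (ger0_norm (mulr_ge0 C0 (g0 t t0))); exact: fg.
Qed.

Lemma cvg_gosc a b p q : 0 < a ->
  (gexp a x * osc b p q x @[x --> +oo] --> (0 : R)) /\
  (gexp a x * osc b p q x @[x --> 0^'+] --> (0 : R)).
Proof.
move=> a0; have [M M0 MP] := gexp_le_ramp a0.
pose S := `|p| + `|q|; have S0 : 0 <= S by rewrite addr_ge0.
have le t : 0 < t -> `|gexp a t * osc b p q t| <= S * M * (ramp a t * (1 + t)^-1).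
  move=> t0; have t1 : 0 < 1 + t by rewrite addr_gt0.
  rewrite normrM (gtr0_norm (gexp_gt0 a t)) mulrC -[leRHS]mulrA.
  apply: ler_pM => //; [exact: ltW (gexp_gt0 a t)|exact: norm_osc_le|].
  apply: (le_trans (MP t t0)); rewrite -mulrA ler_pM2l// ler_pM2l ?expR_gt0//.
  by rewrite lef_pV2 ?posrE ?exprn_gt0// ler_eXnr// lerDl ltW.
split; apply/norm_cvg0P.
  apply: (@squeeze_cvgr _ _ _ _ (cst 0) (fun x => S * M * x^-1)); last 2 first.
  - exact: cvg_cst.
  - have -> : (0 : R) = S * M * 0 by rewrite mulr0.
    by apply: cvgM; [exact: cvg_cst|exact: cvg_inv_pinfty].
  near=> x; have x0 : 0 < x by near: x; exact: nbhs_pinfty_gt.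
  rewrite normr_ge0/=; apply: (le_trans (le x x0)).
  have x1 : 0 < 1 + x by rewrite addr_gt0.
  apply: ler_wpM2l; first by rewrite mulr_ge0// ltW.
  rewrite -[leRHS]mul1r; apply: ler_pM => //.
  - exact: expR_ge0.
  - by rewrite invr_ge0 ltW.
  - exact: ramp_le1 (ltW a0) x0.
  - by rewrite lef_pV2 ?posrE// lerDr.
apply: (@squeeze_cvgr _ _ _ _ (cst 0) (fun x => S * M * ramp a x)); last 2 first.
- exact: cvg_cst.
- have h : S * M * ramp a x @[x --> 0^'+] --> (S * M * 0 : R).
    by apply: cvgM; [exact: cvg_cst|exact: cvg_ramp0].
  by move: h; rewrite mulr0.
near=> x; have x0 : 0 < x by near: x; exact: nbhs_right_gt.
rewrite normr_ge0/=; apply: (le_trans (le x x0)).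
rewrite ler_wpM2l ?mulr_ge0 ?(ltW M0)// ler_piMr ?expR_ge0// invf_le1 ?addr_gt0//.
by rewrite lerDl ltW.
Unshelve. all: by end_near. Qed.

(** The primitive vanishes at both ends.  To stay with nonnegative integrands, add a multiple
    of dramp that makes the integrand nonnegative, and subtract its integral afterwards. *)
Lemma integral_dgosc a b p q : 0 < a ->
  lam.-integrable D (EFin \o dgosc a b p q) /\ \int[lam]_(t in D) dgosc a b p q t = 0.
Proof.
move=> a0; have [C C0 CP] := le_dgosc b p q a0.
have i1 : lam.-integrable D (EFin \o dgosc a b p q).
  apply: (integrable_dominated C0 _ CP _ (integrable_dramp a0)).
    by move=> t; exact: continuous_dgosc.
  by move=> t; apply: dramp_ge0; exact: ltW.
split => //.
have i2 := integrable_dramp a0.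
have i3 : lam.-integrable D (EFin \o (fun t => C * dramp a t)) := integrableZl measurable_D C i2.
pose f t := dgosc a b p q t + C * dramp a t.
pose F t := gexp a t * osc b p q t + C * ramp a t.
have df t : 0 < t -> is_derive t 1 F (f t).
  by move=> t0; exact: (is_deriveD (is_derive_gosc a b p q t0) (is_deriveZ C (is_derive_ramp a t0))).
have cf t : 0 < t -> {for t, continuous f}.
  move=> t0; apply: cvgD; first exact: continuous_dgosc.
  by apply: cvgM; [exact: cvg_cst|exact: continuous_dramp].
have f0 t : 0 < t -> 0 <= f t.
  by move=> t0; have := CP t t0; rewrite ler_norml => /andP[]; rewrite /f -subr_ge0 opprK addrC.
have [Fy F0] := cvg_gosc b p q a0.
have cFy : F x @[x --> +oo] --> (0 + C * 1 : R).
  by apply: cvgD => //; apply: cvgM; [exact: cvg_cst|exact: cvg_ramp1].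
have cF0 : F x @[x --> 0^'+] --> (0 + C * 0 : R).
  by apply: cvgD => //; apply: cvgM; [exact: cvg_cst|exact: cvg_ramp0].
have := ge0_FTC_half_line df cf f0 cFy cF0.
rewrite mulr1 mulr0 !add0r subr0 => intf.
have : \int[lam]_(t in D) f t = C by rewrite /Rintegral intf.
rewrite /f RintegralD// RintegralZl// [X in _ + _ * X = _]/Rintegral (integral_dramp a0) /= mulr1.
by move=> h; apply: (addIr C); rewrite h add0r.
Qed.

(** The real part of (p - i q) times the integrand of Gamma(a + i b). *)
Definition gosc a b p q t := gexp a t / t * osc b p q t.

Lemma integrable_gosc a b p q : 0 < a -> lam.-integrable D (EFin \o gosc a b p q).
Proof.
move=> a0; have [M M0 MP] := gexp_le_dramp a0.
pose S := `|p| + `|q|; have S0 : 0 <= S by rewrite addr_ge0.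
apply: (@integrable_dominated _ (dramp a) (S * M)); last exact: integrable_dramp.
- by rewrite mulr_ge0// ltW.
- move=> t t0; apply: cvgM; last exact: (is_derive_continuous (is_derive_osc b p q t0)).
  apply: cvgM; first exact: (is_derive_continuous (is_derive_gexp a t0)).
  by apply: cvgV; rewrite ?gt_eqF//; exact: cvg_id.
- move=> t t0; have g0 := gexp_gt0 a t.
  have gt0 : 0 <= gexp a t / t by rewrite divr_ge0 ?(ltW g0) ?(ltW t0).
  have gle : gexp a t / t <= M * dramp a t.
    apply: (le_trans _ (MP t t0)); rewrite mulrAC.
    by apply: ler_peMr => //; rewrite lerDl ltW.
  rewrite /gosc normrM (ger0_norm gt0) mulrC -mulrA.
  by apply: ler_pM => //; exact: norm_osc_le.
- by move=> t; apply: dramp_ge0; exact: ltW.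
Qed.

Definition Igosc a b p q : R := \int[lam]_(t in D) gosc a b p q t.

(** Integration by parts. *)
Lemma Igosc_rec a b p q : 0 < a ->
  Igosc (a + 1) b p q = a * Igosc a b p q + b * Igosc a b q (- p).
Proof.
move=> a0; have [i0 h0] := integral_dgosc b p q a0.
have i1 := integrable_gosc b p q a0; have i2 := integrable_gosc b q (- p) a0.
have i3 : lam.-integrable D (EFin \o (fun t => a * gosc a b p q t)) := integrableZl measurable_D a i1.
have i4 : lam.-integrable D (EFin \o (fun t => b * gosc a b q (- p) t)) := integrableZl measurable_D b i2.
have i5 : lam.-integrable D (EFin \o (fun t => a * gosc a b p q t + b * gosc a b q (- p) t)).
  exact (integrableD measurable_D i3 i4).
have -> : Igosc (a + 1) b p q =
    \int[lam]_(t in D) ((a * gosc a b p q t + b * gosc a b q (- p) t) - dgosc a b p q t).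
  apply: eq_Rintegral => t; rewrite inE/= in_itv/= andbT => t0.
  rewrite /gosc gexpS//.
  by rewrite /dgosc [t * _]mulrC mulfK ?gt_eqF//; ring.
by rewrite RintegralB// h0 subr0 RintegralD// !RintegralZl.
Qed.

Lemma IgoscE a b p q : 0 < a -> Igosc a b p q = p * Igosc a b 1 0 + q * Igosc a b 0 1.
Proof.
move=> a0; have i1 := integrable_gosc b 1 0 a0; have i2 := integrable_gosc b 0 1 a0.
have i3 : lam.-integrable D (EFin \o (fun t => p * gosc a b 1 0 t)) := integrableZl measurable_D p i1.
have i4 : lam.-integrable D (EFin \o (fun t => q * gosc a b 0 1 t)) := integrableZl measurable_D q i2.
have -> : Igosc a b p q = \int[lam]_(t in D) (p * gosc a b 1 0 t + q * gosc a b 0 1 t).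
  by apply: eq_Rintegral => t _; rewrite /gosc /osc; ring.
by rewrite RintegralD// !RintegralZl.
Qed.

End half_line.

Section gamma.
Variable R : realType.
Local Notation lam := (@lebesgue_measure R).
Local Notation C := R[i].
Local Notation Rm := (measurableTypeR R).
Local Notation D := (`]0, +oo[%classic : set Rm).

Let measurable_D : measurable D. Proof. exact: measurable_itv. Qed.

Lemma cpowE (t : R) (s : C) : cpow t s =
  (expR (complex.Re s * ln t) * cos (complex.Im s * ln t)) +i*
  (expR (complex.Re s * ln t) * sin (complex.Im s * ln t)).
Proof.
rewrite /cpow /cexp; case: s => a b /=; rewrite !mulr0 subr0 add0r.
by rewrite /GRing.mul/= !mul0r subr0 addr0.
Qed.

Lemma mulCr (a b r : R) : (a +i* b) * r%:C = (a * r) +i* (b * r) :> C.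
Proof. by apply/eqP; rewrite eq_complex /= !mulr0 subr0 add0r !eqxx. Qed.

Definition gamma_fun (s : C) (t : R) : C := cpow t (s - 1) * (expR (- t))%:C.

Lemma gamma_funE s t : 0 < t -> gamma_fun s t =
  gosc (complex.Re s) (complex.Im s) 1 0 t +i* gosc (complex.Re s) (complex.Im s) 0 1 t.
Proof.
move=> t0; rewrite /gamma_fun cpowE raddfB/= raddfB/= subr0.
have -> : expR ((complex.Re s - 1) * ln t) = expR (complex.Re s * ln t) / t.
  by rewrite mulrBl mul1r expRB lnK ?posrE.
have E : gexp (complex.Re s) t = expR (complex.Re s * ln t) * expR (- t) by rewrite /gexp expRD.
rewrite /gosc /osc E !mul1r !mul0r addr0 add0r.
by rewrite mulCr; congr (_ +i* _); ring.
Qed.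

Lemma cintegrable_gamma_fun s : 0 < complex.Re s -> cintegrable lam D (gamma_fun s).
Proof.
move=> s0; have i p q := integrable_gosc (complex.Im s) p q s0.
have e t : D t -> gamma_fun s t = gosc (complex.Re s) (complex.Im s) 1 0 t +i*
    gosc (complex.Re s) (complex.Im s) 0 1 t.
  by rewrite /= in_itv/= andbT; exact: gamma_funE.
split.
  apply: eq_integrable (i 1 0) => // t /set_mem Dt.
  by rewrite (e t Dt).
by apply: eq_integrable (i 0 1) => // t /set_mem Dt; rewrite (e t Dt).
Qed.

Lemma cGammaE (s : C) : cGamma s =
  (Igosc (complex.Re s) (complex.Im s) 1 0 : R) +i*
  (Igosc (complex.Re s) (complex.Im s) 0 1 : R).
Proof.
have e t : D t -> gamma_fun s t = gosc (complex.Re s) (complex.Im s) 1 0 t +i*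
    gosc (complex.Re s) (complex.Im s) 0 1 t.
  by rewrite /= in_itv/= andbT; exact: gamma_funE.
by rewrite /cGamma -/(gamma_fun s) /cintegral; congr (_ +i* _);
  apply: eq_Rintegral => t /set_mem Dt; rewrite (e t Dt).
Qed.

Lemma cGammaS (s : C) : 0 < complex.Re s -> cGamma (s + 1) = s * cGamma s.
Proof.
move=> s0; rewrite !cGammaE raddfD/= raddfD/= addr0 !Igosc_rec//.
rewrite (IgoscE _ 0 (- 1) s0) (IgoscE _ 1 (- 0) s0).
case: s s0 => a b /= _; apply/eqP; rewrite eq_complex /=.
by apply/andP; split; apply/eqP; ring.
Qed.

Lemma normr_sin_le (x : R) : `|sin x| <= `|x|.
Proof.
wlog x0 : x / 0 < x.
  move=> h; have [|x0|<-] := ltgtP 0 x; [exact: h| |by rewrite sin0].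
  by rewrite -normrN -sinN -(normrN x) h// oppr_gt0.
have [c _] := @MVT R sin cos 0 x x0 (fun z _ => is_derive_sin z)
  (continuous_subspaceT (@continuous_sin R)).
by rewrite sin0 !subr0 => ->; rewrite normrM ler_piMl// cos_max.
Qed.

Lemma cos_ge_sqr (x : R) : 1 - x ^+ 2 / 2 <= cos x.
Proof.
have xE : x = (x / 2) *+ 2 by rewrite -mulr_natr divfK.
have -> : cos x = 1 - 2 * sin (x / 2) ^+ 2.
  by rewrite {1}xE cos_mulr2n cos2sin2; ring.
rewrite lerD2l lerN2.
have : `|sin (x / 2)| ^+ 2 <= `|x / 2| ^+ 2 by rewrite lerXn2r ?nnegrE// normr_sin_le.
rewrite !real_normK ?num_real// => h; rewrite [leRHS](_ : _ = 2 * (x / 2) ^+ 2); first by rewrite ler_pM2l.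
by field.
Qed.

(** With v = ln r / 2 the claim reads v ^ 2 <= (2 sinh v) ^ 2. *)
Lemma ln_sqr_le (r : R) : 0 < r -> ln r ^+ 2 <= 4 * (r + r^-1 - 2).
Proof.
move=> r0; pose v := ln r / 2.
have vE : ln r = v + v by rewrite /v; field.
have rE : r = expR v ^+ 2 by rewrite -[LHS](@lnK R) ?posrE// vE expRD expr2.
have e0 := expR_gt0 v.
have h : v ^+ 2 <= (expR v - expR (- v)) ^+ 2.
  have key (u : R) : 0 <= u -> u <= expR u - expR (- u).
    move=> u0; have h1 := expR_ge1Dx u.
    have h2 : expR (- u) <= 1 by rewrite expR_le1 oppr_le0.
    by move: h1 h2; lra.
  rewrite -[v ^+ 2]real_normK ?num_real// -[leRHS]real_normK ?num_real//.
  rewrite lerXn2r ?nnegrE//; have [v0|v0] := leP 0 v.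
    by rewrite ger0_norm// (le_trans (key _ v0))// ler_norm.
  rewrite ltr0_norm// -normrN opprB (le_trans _ (ler_norm _))//.
  by have := key (- v); rewrite opprK; apply; rewrite oppr_ge0 ltW.
rewrite vE; have -> : r + r^-1 - 2 = (expR v - expR (- v)) ^+ 2.
  by rewrite rE expRN; field; rewrite gt_eqF.
have -> : (v + v) ^+ 2 = 4 * v ^+ 2 by ring.
by rewrite ler_pM2l.
Qed.

(** On the real axis Euler's integral is real; Gam is its value. *)
Local Notation Gam x := (Igosc x 0 1 0).

Lemma Gam_rec (x : R) : 0 < x -> Gam (x + 1) = x * Gam x.
Proof. by move=> x0; rewrite Igosc_rec// mul0r addr0. Qed.

Lemma gosc10 (x t : R) : gosc x 0 1 0 t = gexp x t / t.
Proof. by rewrite /gosc /osc mul0r cos0 mulr1 mul0r addr0 mulr1. Qed.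

Lemma Gam_gt0 (x : R) : 0 < x -> 0 < Gam x.
Proof.
move=> x0; have ix := integrable_gosc 0 1 0 x0.
rewrite /Igosc /Rintegral fine_gt0//; apply/andP; split; last first.
  by have := integrable_fin_num measurable_D ix; rewrite fin_numElt => /andP[].
have f0 t : D t -> (0 <= (gosc x 0 1 0 t)%:E)%E.
  by rewrite /= in_itv/= andbT => t0; rewrite gosc10 lee_fin divr_ge0 ?expR_ge0// ltW.
pose c : R := expR (- 2) / 2.
have c0 : 0 < c by rewrite divr_gt0 ?expR_gt0.
pose I12 : set Rm := `[1, 2]%classic.
have mI : measurable I12 by exact: measurable_itv.
have ID : I12 `<=` D.
  by move=> t; rewrite /I12/= !in_itv/= andbT => /andP[t1 _]; exact: lt_le_trans t1.
have mf : measurable_fun D (fun t => (gosc x 0 1 0 t)%:E) := measurable_int lam ix.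
apply: (@lt_le_trans _ _ (\int[lam]_(t in I12) (gosc x 0 1 0 t)%:E)%E); last exact: ge0_subset_integral.
apply: (@lt_le_trans _ _ (\int[lam]_(t in I12) (cst c%:E) t)%E).
  rewrite integral_cst//= lebesgue_measure_itv/= lte_fin ltr1n -EFinB -EFinM lte_fin.
  by rewrite mulr_gt0// subr_gt0 ltr1n.
apply: ge0_le_integral => //.
- by move=> t _; rewrite lee_fin ltW.
- exact: measurable_funS mf.
move=> t; rewrite /I12/= in_itv/= => /andP[t1 t2]; have t0 : 0 < t := lt_le_trans ltr01 t1.
rewrite lee_fin gosc10 ler_pM ?expR_ge0 ?invr_ge0//; last by rewrite lef_pV2 ?posrE.
rewrite ler_expR; have := mulr_ge0 (ltW x0) (ln_ge0 t1); move: t2; lra.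
Qed.

(** The real part of X ^ (- i y) * Gamma(X + i y) is the integral of
    t ^ (X - 1) * e ^ (- t) * cos (y ln (t / X)), and
    cos (y ln (t / X)) >= 1 - 2 y ^ 2 * (t / X + X / t - 2).  The integral of the lower bound
    only involves Gamma(X - 1), Gamma(X) and Gamma(X + 1), and equals
    Gamma(X - 1) * (X - 1 - 2 y ^ 2). *)
Lemma cGamma_line_neq0 (X y : R) : 1 < X -> 2 * y ^+ 2 < X - 1 -> cGamma (X +i* y) != 0.
Proof.
move=> X1 yX; have X0 : 0 < X := lt_trans ltr01 X1.
have X10 : 0 < X - 1 by rewrite subr_gt0.
rewrite cGammaE /=; apply/negP => /eqP[G0 G1].
(* the phase X ^ (- i y), which turns the oscillating factor into 1 at t = X *)
pose p := cos (y * ln X); pose q := sin (y * ln X).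
have : Igosc X y p q = 0 by rewrite IgoscE// G0 G1 !mulr0 addr0.
apply/eqP; rewrite gt_eqF//.
have i0 := integrable_gosc y p q X0.
have iG := integrable_gosc 0 1 0 X0.
have iG1 := integrable_gosc 0 1 0 (addr_gt0 X0 ltr01).
have iGm := integrable_gosc 0 1 0 X10.
pose k := 2 * y ^+ 2.
have iA : lam.-integrable D (EFin \o (fun t => (1 + k * 2) * gosc X 0 1 0 t)) := integrableZl measurable_D _ iG.
have iB : lam.-integrable D (EFin \o (fun t => k / X * gosc (X + 1) 0 1 0 t)) := integrableZl measurable_D _ iG1.
have iC : lam.-integrable D (EFin \o (fun t => k * X * gosc (X - 1) 0 1 0 t)) := integrableZl measurable_D _ iGm.
have iAB : lam.-integrable D (EFin \o (fun t => (1 + k * 2) * gosc X 0 1 0 t - k / X * gosc (X + 1) 0 1 0 t)).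
  exact (integrableB measurable_D iA iB).
(* t ^ (X - 1) * e ^ (- t) * (1 - k * (t / X + X / t - 2)) *)
pose h t := ((1 + k * 2) * gosc X 0 1 0 t - k / X * gosc (X + 1) 0 1 0 t) - k * X * gosc (X - 1) 0 1 0 t.
have ih : lam.-integrable D (EFin \o h) by exact (integrableB measurable_D iAB iC).
have hE : \int[lam]_(t in D) h t = (1 + k * 2) * Gam X - k / X * Gam (X + 1) - k * X * Gam (X - 1).
  by rewrite RintegralB// RintegralB// !RintegralZl.
have G0' := Gam_gt0 X10.
apply: (@lt_le_trans _ _ (\int[lam]_(t in D) h t)).
  have GX : Gam X = (X - 1) * Gam (X - 1) by rewrite -(Gam_rec X10) subrK.
  rewrite hE (Gam_rec X0) GX.
  set g := Gam (X - 1) in G0' *.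
  have -> : (1 + k * 2) * ((X - 1) * g) - k / X * (X * ((X - 1) * g)) - k * X * g = g * (X - 1 - k).
    by field; rewrite gt_eqF.
  by rewrite mulr_gt0// subr_gt0.
apply: le_Rintegral => // t; rewrite /= in_itv/= andbT => t0.
have gE : gosc (X + 1) 0 1 0 t = gosc X 0 1 0 t * t.
  by rewrite !gosc10 gexpS// [t * _]mulrC mulrAC.
have gE' : gosc (X - 1) 0 1 0 t = gosc X 0 1 0 t / t.
  have -> : gosc X 0 1 0 t = gexp (X - 1) t * t / t.
    by rewrite gosc10 -(mulrC t) -gexpS// subrK.
  by rewrite gosc10 mulfK ?gt_eqF.
rewrite /h gE gE'; set g := gosc X 0 1 0 t.
have g0 : 0 <= g by rewrite /g gosc10 divr_ge0 ?expR_ge0// ltW.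
have -> : gosc X y p q t = g * cos (y * ln (t / X)).
  by rewrite /g gosc10 /gosc ln_div ?posrE// mulrBr cosB /osc /p /q; ring.
have r0 : 0 < t / X by rewrite divr_gt0.
have hc : 1 - k * (t / X + (t / X)^-1 - 2) <= cos (y * ln (t / X)).
  apply: (le_trans _ (cos_ge_sqr _)); rewrite lerD2l lerN2 exprMn /k.
  have := ler_wpM2l (sqr_ge0 y) (ln_sqr_le r0); set w := _ + _ - 2.
  have -> : 2 * y ^+ 2 * w = y ^+ 2 * (4 * w) / 2 by field.
  by rewrite ler_pM2r.
apply: (le_trans _ (ler_wpM2l g0 hc)); rewrite le_eqVlt; apply/orP; left; apply/eqP.
by field; rewrite !gt_eqF.
Qed.

(** Translate s by an integer such that the real part exceeds 1 + 2 y ^ 2. *)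
Lemma cGamma_neq0 (s : C) : 0 < complex.Re s -> cGamma s != 0.
Proof.
move=> s0.
have shift n : cGamma s = 0 -> cGamma (s + n%:R) = 0.
  elim: n => [|n IH] h; first by rewrite addr0.
  rewrite -natr1 addrA cGammaS ?IH ?mulr0// raddfD/= (lt_le_trans s0)// lerDl.
  by rewrite raddfMn/= mulrn_wge0.
pose y := complex.Im s; pose n := (Num.truncn (2 * y ^+ 2 + 1)).+1.
apply/negP => /eqP/(shift n).
have -> : s + n%:R = (complex.Re s + n%:R) +i* y.
  rewrite /y; move: n => m; case: s {s0 shift y} => a b /=; apply/eqP.
  by rewrite eq_complex raddfD raddfMn raddfD raddfMn /= mul0rn addr0 !eqxx.
have hn : 2 * y ^+ 2 + 1 < n%:R by rewrite truncnS_gt.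
apply/eqP; apply: cGamma_line_neq0.
  by rewrite (@lt_le_trans _ _ n%:R) ?lerDr ?(ltW s0)// (le_lt_trans _ hn)// lerDr mulr_ge0 ?sqr_ge0.
by move: hn s0; lra.
Qed.

End gamma.

(** * The Beta integral of one pivot *)

Section complex_power.
Variable R : realType.
Local Notation C := R[i].
Local Notation Rm := (measurableTypeR R).
Implicit Types (a b : R) (s t : C).

Lemma cexpD s t : cexp (s + t) = cexp s * cexp t.
Proof.
rewrite /cexp; case: s t => [a b] [c e] /=; rewrite expRD cosD sinD rmorphM /=.
rewrite mulrACA; congr (_ * _); apply/eqP; rewrite eq_complex /=.
by apply/andP; split; apply/eqP => //; rewrite addrC [cos b * _]mulrC [sin e * _]mulrC.
Qed.

Lemma cexp0 : cexp 0 = 1 :> C.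
Proof. by rewrite /cexp /= expR0 cos0 sin0 mul1r. Qed.

Lemma cpow0 a : cpow a 0 = 1.
Proof. by rewrite /cpow mul0r cexp0. Qed.

Lemma cpowD a s t : cpow a (s + t) = cpow a s * cpow a t.
Proof. by rewrite /cpow mulrDl cexpD. Qed.

Lemma cpowNK a s : cpow a (- s) * cpow a s = 1.
Proof. by rewrite -cpowD addNr cpow0. Qed.

Lemma cpow_neq0 a s : cpow a s != 0.
Proof. by apply/eqP => s0; have /esym/eqP := cpowNK a s; rewrite s0 mulr0 oner_eq0. Qed.

Lemma cpowN a s : cpow a (- s) = (cpow a s)^-1.
Proof. by apply: (mulIf (cpow_neq0 a s)); rewrite cpowNK mulVf ?cpow_neq0. Qed.

Lemma cpowB a s t : cpow a (s - t) = cpow a s / cpow a t.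
Proof. by rewrite cpowD cpowN. Qed.

Lemma cpowM a b s : 0 < a -> 0 < b -> cpow (a * b) s = cpow a s * cpow b s.
Proof. by move=> a0 b0; rewrite /cpow lnM ?posrE// rmorphD mulrDr cexpD. Qed.

Lemma cpow_nat a n : 0 < a -> cpow a n%:R = (a ^+ n)%:C.
Proof.
move=> a0; elim: n => [|n IH]; first by rewrite cpow0 expr0.
rewrite -natr1 cpowD IH exprSr rmorphM; congr (_ * _).
by rewrite /cpow mul1r /cexp /= lnK ?posrE// cos0 sin0 mulr1.
Qed.

Lemma cmeasurable_cpow d (X : measurableType d) (f : X -> R) s :
  measurable_fun setT (f : X -> Rm) -> cmeasurable (fun x => cpow (f x) s).
Proof.
move=> mf; under [X in cmeasurable X]eq_fun do rewrite cpowE.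
have ml (c : R) : measurable_fun setT (fun x => c * ln (f x) : Rm).
  by apply: measurable_funM => //; apply: (measurableT_comp (@measurable_ln R)).
have mexp c : measurable_fun setT (fun x => expR (c * ln (f x)) : Rm).
  exact: (measurableT_comp (@measurable_expR R) (ml c)).
apply: cmeasurable_complex; apply: measurable_funM; try exact: mexp.
  exact: (measurableT_comp (continuous_measurable_fun (@continuous_cos R)) (ml _)).
exact: (measurableT_comp (continuous_measurable_fun (@continuous_sin R)) (ml _)).
Qed.

Lemma cmeasurable_real d (X : measurableType d) (f : X -> R) :
  measurable_fun setT (f : X -> Rm) -> cmeasurable (fun x => (f x)%:C).
Proof. by move=> mf; apply: cmeasurable_complex. Qed.

Lemma cmeasurable_gamma_fun s : cmeasurable (gamma_fun s : Rm -> C).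
Proof.
apply: cmeasurableM; first exact: cmeasurable_cpow.
apply: cmeasurable_real; apply: (measurableT_comp (@measurable_expR R)).
exact: measurable_funN.
Qed.

End complex_power.

Section gamma_scale.
Variable R : realType.
Local Notation C := R[i].
Local Notation Rm := (measurableTypeR R).
Local Notation lam := (@lebesgue_measure R).

Lemma cGamma_pos (s : C) : 0 < complex.Re s ->
  cintegrable lam setT (fun t : Rm => (pos t)%:C * gamma_fun s t) /\
  cintegral lam setT (fun t : Rm => (pos t)%:C * gamma_fun s t) = cGamma s.
Proof.
move=> s0; split; last by rewrite /cGamma [RHS]cintegral_mkcond.
have mD : measurable (`]0, +oo[%classic : set Rm) by exact: measurable_itv.
exact: (proj1 (cintegrable_mkcond lam (gamma_fun s) mD) (cintegrable_gamma_fun s0)).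
Qed.

Lemma pos_scale (r u : R) : 0 < r -> pos (r * u) = pos u.
Proof.
move=> r0; have [u0|u0] := pselect (0 < u); first by rewrite !pos_gt0// mulr_gt0.
by rewrite !pos_le0// pmulr_rgt0.
Qed.

Lemma ge0_integral_scale (r : R) (f : Rm -> R) : 0 < r -> measurable_fun setT f ->
  (forall x, 0 <= f x) ->
  (\int[lam]_x (pos x * f (r * x))%:E = (r^-1)%:E * \int[lam]_x (pos x * f x)%:E)%E.
Proof.
move=> r0 mf f0.
have mg : measurable_fun setT (fun x : Rm => (pos x * f x)%:E).
  by apply/measurable_EFinP; apply: measurable_funM => //; exact: measurable_pos.
rewrite (ge0_integral_affine 0 r0 mg); last by move=> x; rewrite lee_fin mulr_ge0 ?pos_ge0.
rewrite muleA -EFinM mulVf ?gt_eqF// mul1e.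
by apply: eq_integral => x _; rewrite addr0 pos_scale.
Qed.

(** The case of a single factor of [cintegral_prod], applied to the scaling by r. *)
Lemma cGamma_scale (r : R) (s : C) : 0 < r -> 0 < complex.Re s ->
  let f := fun u : Rm => (pos u)%:C * (cpow u (s - 1) * (expR (- (r * u)))%:C) in
  cintegrable lam setT f /\ cintegral lam setT f = cpow r (- s) * cGamma s.
Proof.
move=> r0 s0 f.
have [is0 isE] := cGamma_pos s0.
have [] := @cintegral_prod R _ Rm lam _ Rm 1 _ (fun=> Rm) (fun=> lam) (fun=> ( *%R r))
  (fun=> id) (@pos R) (fun=> @pos R) r^-1 _ _ _ _ _ (fun=> gamma_fun s) _ _.
- by move=> _; exact: measurable_funM.
- exact: measurable_pos.
- by move=> x; exact: pos_ge0.
- by move=> _ z; exact: pos_ge0.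
- move=> phi mphi phi0; rewrite big_ord1 -(ge0_integral_scale r0 (mphi _) (phi0 _)).
  by apply: eq_integral => x _; rewrite big_ord1.
- by move=> _; exact: cmeasurable_gamma_fun.
- by move=> _.
rewrite big_ord1 isE.
have -> : (fun x : Rm => (pos x)%:C * \prod_(i < 1) gamma_fun s (r * x)) =
    (fun x => cpow r (s - 1) * f x).
  apply/funext => x; rewrite big_ord1 /f; have [x0|x0] := pselect (0 < x); last first.
    by rewrite pos_le0// !mul0r mulr0.
  by rewrite /gamma_fun cpowM//; ring.
move=> i1 e1.
have c0 := cpow_neq0 r (s - 1).
have fE : f = (fun x => (cpow r (s - 1))^-1 * (cpow r (s - 1) * f x)).
  by apply/funext => x; rewrite mulKf.
have [i2 e2] := cintegralZl (cpow r (s - 1))^-1 i1.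
rewrite fE; split; first exact: i2.
rewrite e2 e1 mulrA; congr (_ * _).
by rewrite -cpowN opprB cpowB -[1](mulr1n 1) cpow_nat// expr1 fmorphV mulrAC mulfV ?mul1r ?cpowN// fmorph_eq0 gt_eqF.
Qed.

End gamma_scale.

Section gaussian.
Variable R : realType.
Local Notation lam := (@lebesgue_measure R).
Local Notation Rm := (measurableTypeR R).
Local Notation L := (@lebesgue_tuple R).
Local Notation Cn n := (n.-tuple Rm * n.-tuple Rm)%type.
Local Notation mC n := (prodm (L n) (L n)).

Lemma measurable_gauss (c : R) : measurable_fun setT (fun x : Rm => (expR (- c * x ^+ 2))%:E).
Proof.
apply/measurable_EFinP; apply: (measurableT_comp (@measurable_expR R)).
by apply: measurable_funM => //; exact: measurable_funX.
Qed.

Lemma integral_gauss (c : R) : 0 < c ->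
  (\int[lam]_x (expR (- c * x ^+ 2))%:E = (Num.sqrt (pi / c))%:E)%E.
Proof.
move=> c0; have s0 : 0 < Num.sqrt c by rewrite sqrtr_gt0.
have := @integralT_gauss R; rewrite /gauss_fun.
under eq_integral => x _ do rewrite -mulN1r.
rewrite (ge0_integral_affine 0 s0 (measurable_gauss 1)); last by move=> x; rewrite lee_fin expR_ge0.
under eq_integral => x _ do rewrite addr0 exprMn sqr_sqrtr ?ltW// mulrA mulN1r.
move=> h; rewrite sqrtrM ?pi_ge0// sqrtrV ?ltW// mulrC EFinM.
by rewrite -h muleA -EFinM mulVf ?gt_eqF// mul1e.
Qed.

Lemma measurable_gauss_nsq n (c : R) : measurable_fun setT (fun w : Cn n => (expR (- c * nsq w))%:E).
Proof.
apply/measurable_EFinP; apply: (measurableT_comp (@measurable_expR R)).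
by apply: measurable_funM => //; exact: measurable_nsq.
Qed.

Lemma integral_gauss_nsq n (c : R) : 0 < c ->
  (\int[mC n]_w (expR (- c * nsq w))%:E = ((pi / c) ^+ n)%:E)%E.
Proof.
move=> c0; elim: n => [|n IH].
  rewrite (ge0_tonelli (L 0) (L 0) (measurable_gauss_nsq _)); last by move=> x; rewrite lee_fin expR_ge0.
  rewrite /= integral_dirac//; last first.
    apply: (measurable_fun_integral (L 0) (measurable_gauss_nsq c)) => x; rewrite lee_fin expR_ge0//.
  rewrite integral_dirac//; last exact: (measurable_fun_pair2 _ (measurable_gauss_nsq c)).
  by rewrite !diracE !in_setT !mul1e /nsq big_ord0 mulr0 expR0 expr0.
rewrite (ge0_integral_ccons (measurable_gauss_nsq _)); last by move=> x; rewrite lee_fin expR_ge0.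
pose K := ((pi / c) ^+ n)%:E.
have K0 : (0 <= K)%E by rewrite lee_fin exprn_ge0// divr_ge0 ?pi_ge0// ltW.
have g0 (x : R) : (0 <= (expR (- c * x ^+ 2))%:E)%E by rewrite lee_fin expR_ge0.
transitivity (\int[prodm lam lam]_z ((expR (- c * z.1 ^+ 2))%:E * ((expR (- c * z.2 ^+ 2))%:E * K)))%E.
  apply: eq_integral => z _; rewrite /K -IH -ge0_integralZl//; last exact: measurable_gauss_nsq.
  rewrite -ge0_integralZl//; last first.
    by apply: emeasurable_funM => //; exact: measurable_gauss_nsq.
  by apply: eq_integral => w _; rewrite nsq_ccons -!EFinM -!expRD !mulrDr addrA.
rewrite (ge0_tonelli lam lam); last 2 first.
- apply: emeasurable_funM; first by apply: (measurableT_comp (measurable_gauss c)); mproj.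
  by apply: emeasurable_funM => //; apply: (measurableT_comp (measurable_gauss c)); mproj.
- by move=> z; rewrite !mule_ge0.
under eq_integral => x _.
  rewrite /= ge0_integralZl//; last 2 first.
  - by apply: emeasurable_funM => //; exact: measurable_gauss.
  - by move=> y _; rewrite mule_ge0.
  rewrite ge0_integralZr//; last exact: measurable_gauss.
  rewrite integral_gauss//.
  over.
rewrite ge0_integralZr//; last 2 first.
- exact: measurable_gauss.
- by rewrite mule_ge0// lee_fin sqrtr_ge0.
rewrite integral_gauss// /K -!EFinM mulrA -expr2 sqr_sqrtr ?exprS//.
by rewrite divr_ge0 ?pi_ge0// ltW.
Qed.

End gaussian.

Section beta.
Variable R : realType.
Local Notation C := R[i].
Local Notation lam := (@lebesgue_measure R).
Local Notation Rm := (measurableTypeR R).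
Local Notation L := (@lebesgue_tuple R).
Local Notation Cn n := (n.-tuple Rm * n.-tuple Rm)%type.
Local Notation mC n := (prodm (L n) (L n)).

(** The kernel at ((s, w), u).  With al x = x ^ (a - 1) * e ^ (- x),
    be x = x ^ (b - 1) * e ^ (- x), z = a + b + m and r = 1 + s + |w|^2, its product with
    al (s u) * be u is s ^ (a - 1) * u ^ (z - 1) * e ^ (- u r). *)
Definition beta_kernel m (x : (Rm * Cn m) * Rm) : R :=
  pos x.1.1 * pos x.2 * `|x.2| ^+ m.+1 * expR (- x.2 * nsq x.1.2).

Lemma measurable_beta_kernel m : measurable_fun setT (@beta_kernel m).
Proof.
apply: measurable_funM; last first.
  apply: (measurableT_comp (@measurable_expR R)); apply: measurable_funM.
    by apply: measurable_funN; mproj.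
  by apply: (measurableT_comp (@measurable_nsq R m)); mproj.
apply: measurable_funM; first apply: measurable_funM.
- by apply: (measurableT_comp (@measurable_pos R)); mproj.
- by apply: (measurableT_comp (@measurable_pos R)); mproj.
by apply: measurable_funX; apply: measurableT_comp => //; mproj.
Qed.

Lemma beta_kernel_ge0 m x : 0 <= @beta_kernel m x.
Proof. by rewrite /beta_kernel !mulr_ge0 ?pos_ge0 ?expR_ge0 ?exprn_ge0. Qed.

(** For fixed u the Gaussian integral over w is (pi / u) ^ m and the scaling of s by u yields
    a factor u^-1; together they cancel the power m + 1 of u in the kernel. *)
Lemma integral_beta_kernel m (al be : Rm -> R) :
  measurable_fun setT al -> measurable_fun setT be ->
  (forall x, 0 <= al x) -> (forall x, 0 <= be x) ->
  (\int[prodm (prodm lam (mC m)) lam]_x (beta_kernel x * (al (x.1.1 * x.2) * be x.2))%:E =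
   (pi ^+ m)%:E * (\int[lam]_x (pos x * al x)%:E * \int[lam]_x (pos x * be x)%:E))%E.
Proof.
move=> mal mbe al0 be0.
pose f (x : (Rm * Cn m) * Rm) := (beta_kernel x * (al (x.1.1 * x.2) * be x.2))%:E.
have mf : measurable_fun setT f.
  apply/measurable_EFinP; apply: measurable_funM; first exact: measurable_beta_kernel.
  apply: measurable_funM; last by apply: (measurableT_comp mbe); mproj.
  by apply: (measurableT_comp mal); apply: measurable_funM; mproj.
have f0 x : (0 <= f x)%E by rewrite lee_fin !mulr_ge0 ?beta_kernel_ge0.
rewrite (ge0_tonelli (prodm lam (mC m)) lam mf f0) (ge0_tonelli_swap (prodm lam (mC m)) lam mf f0).
pose A := (\int[lam]_x (pos x * al x)%:E)%E.
have A0 : (0 <= A)%E by apply: integral_ge0 => x _; rewrite lee_fin mulr_ge0 ?pos_ge0.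
transitivity (\int[lam]_u ((pos u * be u)%:E * ((pi ^+ m)%:E * A)))%E; last first.
  rewrite ge0_integralZr//; last 3 first.
  - by apply/measurable_EFinP; apply: measurable_funM => //; exact: measurable_pos.
  - by move=> x _; rewrite lee_fin mulr_ge0 ?pos_ge0.
  - by rewrite mule_ge0// lee_fin exprn_ge0// pi_ge0.
  by rewrite muleC muleA.
apply: eq_integral => u _.
have [u0|u0] := pselect (0 < u); last first.
  rewrite pos_le0// mul0r mul0e integral0_eq// => x _.
  by rewrite /f /beta_kernel /= (pos_le0 u0) mulr0 !mul0r.
have mfu : measurable_fun setT (fun z => f (z, u)) := measurable_fun_pair1 u mf.
rewrite (ge0_tonelli lam (mC m) mfu (fun=> f0 _)).
have malu : measurable_fun setT (fun s : Rm => (pos s * al (u * s))%:E).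
  apply/measurable_EFinP; apply: measurable_funM; first exact: measurable_pos.
  by apply: (measurableT_comp mal); exact: measurable_funM.
transitivity (\int[lam]_s ((pos s * al (u * s))%:E * (u * be u * pi ^+ m)%:E))%E.
  apply: eq_integral => s _.
  transitivity (\int[mC m]_w ((pos s * al (u * s) * u ^+ m.+1 * be u)%:E * (expR (- u * nsq w))%:E))%E.
    apply: eq_integral => w _; rewrite /f /beta_kernel /= (pos_gt0 u0) (gtr0_norm u0) -EFinM.
    by rewrite [s * u]mulrC; congr EFin; ring.
  rewrite ge0_integralZl//; last 2 first.
  - exact: measurable_gauss_nsq.
  - by rewrite lee_fin !mulr_ge0 ?pos_ge0// exprn_ge0// ltW.
  rewrite integral_gauss_nsq// -!EFinM expr_div_n; congr EFin.
  by rewrite exprS; field; rewrite expf_neq0// gt_eqF.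
rewrite ge0_integralZr//; last 2 first.
- by move=> s _; rewrite lee_fin mulr_ge0 ?pos_ge0.
- by rewrite lee_fin !mulr_ge0 ?exprn_ge0 ?pi_ge0// ltW.
rewrite (ge0_integral_scale u0 mal al0) -/A (pos_gt0 u0) mul1r.
rewrite muleAC -EFinM [RHS]muleA -EFinM; congr (_%:E * _)%E.
by field; rewrite gt_eqF.
Qed.

Definition pivot_power m (a z : C) (x : Rm * Cn m) : C :=
  (pos x.1)%:C * (cpow x.1 (a - 1) * cpow (1 + x.1 + nsq x.2) (- z)).

(** The integral of the kernel against the two Gamma integrands, computed in two ways: it is
    pi ^ m * Gamma(a) * Gamma(b) by [integral_beta_kernel], and Gamma(z) times the wanted
    integral if u is integrated first. *)
Lemma cintegral_pivot_power m (a b : C) : 0 < complex.Re a -> 0 < complex.Re b ->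
  let f := @pivot_power m a (a + b + m%:R) in
  cintegrable (prodm lam (mC m)) setT f /\
  cintegral (prodm lam (mC m)) setT f =
    (pi ^+ m)%:C * (cGamma a * cGamma b / cGamma (a + b + m%:R)).
Proof.
move=> a0 b0 f; pose z : C := a + b + m%:R.
have z0 : 0 < complex.Re z.
  by rewrite /z !raddfD/= raddfMn/= (lt_le_trans (addr_gt0 a0 b0))// lerDl mulrn_wge0.
have [ia ea] := cGamma_pos a0; have [ib eb] := cGamma_pos b0.
pose phi (i : 'I_2) : Rm -> C := if i == ord0 then gamma_fun a else gamma_fun b.
have [] := @cintegral_prod R _ ((Rm * Cn m) * Rm)%type (prodm (prodm lam (mC m)) lam) _ Rm 2 _
  (fun=> Rm) (fun=> lam)
  (fun i x => if i == ord0 then x.1.1 * x.2 else x.2)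
  (fun=> id) (@beta_kernel m) (fun=> @pos R) (pi ^+ m) _ _ _ _ _ phi _ _.
- move=> i; case: (i == ord0); last by mproj.
  by apply: measurable_funM; mproj.
- exact: measurable_beta_kernel.
- exact: beta_kernel_ge0.
- by move=> _ x; exact: pos_ge0.
- move=> psi mpsi psi0; rewrite big_ord_recl big_ord1 -integral_beta_kernel//.
  by apply: eq_integral => x _; rewrite big_ord_recl big_ord1.
- by move=> i; rewrite /phi; case: (i == ord0); exact: cmeasurable_gamma_fun.
- by move=> i; rewrite /phi; case: (i == ord0).
rewrite big_ord_recl big_ord1 /phi /= ea eb.
under [X in cintegrable _ _ X]eq_fun do rewrite big_ord_recl big_ord1 /=.
under [X in cintegral _ _ X]eq_fun do rewrite big_ord_recl big_ord1 /=.
pose g (x : (Rm * Cn m) * Rm) : C := ((pos x.1.1)%:C * cpow x.1.1 (a - 1)) *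
  ((pos x.2)%:C * (cpow x.2 (z - 1) * (expR (- ((1 + x.1.1 + nsq x.1.2) * x.2)))%:C)).
have gE : (fun x => (beta_kernel x)%:C * (gamma_fun a (x.1.1 * x.2) * gamma_fun b x.2)) = g.
  apply/funext => -[[s w] u]; rewrite /g /beta_kernel /=.
  have [s0|s0] := pselect (0 < s); last by rewrite (pos_le0 s0) !mul0r.
  have [u0|u0] := pselect (0 < u); last by rewrite (pos_le0 u0) mulr0 !mul0r mulr0.
  rewrite (pos_gt0 s0) (pos_gt0 u0) !mul1r (gtr0_norm u0) /gamma_fun cpowM//.
  have -> : cpow u (z - 1) = (u ^+ m.+1)%:C * cpow u (a - 1) * cpow u (b - 1).
    by rewrite -cpow_nat// -!cpowD -natr1 /z; congr cpow; ring.
  have -> : - ((1 + s + nsq w) * u) = - u * nsq w + - (s * u) + - u by ring.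
  by rewrite !expRD !rmorphM /=; ring.
rewrite gE => ig eg.
have inner (x : Rm * Cn m) : cintegrable lam setT (fun u => g (x, u)) /\
    cintegral lam setT (fun u => g (x, u)) = cGamma z * f x.
  have [s0|s0] := pselect (0 < x.1); last first.
    rewrite /f /pivot_power /g /= (pos_le0 s0).
    under [X in cintegrable _ _ X]eq_fun do rewrite !mul0r.
    under [X in cintegral _ _ X]eq_fun do rewrite !mul0r.
    rewrite mul0r mulr0; split; first by split; exact: integrable0.
    by rewrite /cintegral /= Rintegral_cst// mul0r.
  have r0 : 0 < 1 + x.1 + nsq x.2.
    by rewrite ltr_pwDl ?addr_gt0// /nsq sumr_ge0// => i _; rewrite addr_ge0 ?sqr_ge0.
  have [i1 e1] := cGamma_scale r0 z0.
  have [i2 e2] := cintegralZl ((pos x.1)%:C * cpow x.1 (a - 1)) i1.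
  split; first exact: i2.
  rewrite [LHS]e2 e1 /f /pivot_power -/z; ring.
have [] := cintegral_fubini ig (fun x => proj1 (inner x)).
rewrite (funext (fun x => proj2 (inner x))) eg => i1 e1.
have G0 := cGamma_neq0 z0.
have [i2 e2] := cintegralZl (cGamma z)^-1 i1.
have fE : f = (fun x => (cGamma z)^-1 * (cGamma z * f x)) by apply/funext => x; rewrite mulKf.
rewrite fE; split; first exact: i2.
rewrite -/z; apply: (etrans e2).
rewrite e1.
by rewrite [LHS]mulrC -!mulrA.
Qed.

End beta.

(** * The integrand in terms of the pivots *)

Section pivot_integrand.
Variables (R : realType) (n : nat).
Local Notation C := R[i].
Implicit Type T : 'M[C]_n.

Lemma cpow1 (s : C) : cpow 1 s = 1.
Proof. by rewrite /cpow ln1 mulr0 cexp0. Qed.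

Lemma norm_expr_cpow (s r : R) (a b : C) m : 0 < s -> 0 < r ->
  (`|s * r| ^+ m)%:C * (cpow s a * cpow r b) = cpow s (a + m%:R) * cpow r (b + m%:R).
Proof.
move=> s0 r0; rewrite !cpowD (cpow_nat m s0) (cpow_nat m r0) gtr0_norm ?mulr_gt0//.
by rewrite exprMn rmorphM /= mulrC mulrACA.
Qed.

(** Summation by parts; the boundary terms vanish because of L 0 = 1 and mu n.+1 = 0. *)
Lemma prod_cpow_telescope (L : nat -> R) (mu : nat -> C) :
  L 0 = 1 -> (forall k, (k <= n)%N -> 0 < L k) -> mu n.+1 = 0 ->
  \prod_(j < n) cpow (L j.+1) (mu j.+1 - mu j.+2) =
  \prod_(j < n) cpow (pratio (L j.+1) (L j)) (mu j.+1).
Proof.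
move=> L0 Lpos mun.
suff H m : (m <= n)%N ->
    \prod_(j < m) cpow (L j.+1) (mu j.+1 - mu j.+2) * cpow (L m) (mu m.+1) =
    \prod_(j < m) cpow (pratio (L j.+1) (L j)) (mu j.+1).
  by rewrite -H// mun cpow0 mulr1.
elim: m => [|m IH] mn; first by rewrite !big_ord0 L0 cpow1 mulr1.
have Lm := Lpos m (ltnW mn); have Lm1 := Lpos m.+1 mn.
rewrite !big_ord_recr/= -IH 1?ltnW// cpowB -[RHS]mulrA -[LHS]mulrA; congr (_ * _).
by rewrite divfK ?cpow_neq0// pratioE// -cpowM ?divr_gt0// mulrC divfK ?gt_eqF.
Qed.

Lemma upper_block_add1 (j : 'I_n) T : 1%:M + upper_block j T = upper_block j (1%:M + T).
Proof. by apply/matrixP => a b; rewrite !mxE. Qed.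

Definition pivot_factor (lam sig : nat -> C) (k : nat) (y : R * R) : C :=
  cpow y.1 (lam k.+1 - n%:R) * cpow y.2 (- sig k.+1).

(** Summation by parts for the leading minors of T and of 1 + T, whose successive quotients
    are the pivots; as det T is the product of the pivots of T, the factor det T ^ - n lowers
    each exponent by n. *)
Lemma beta_integrand_pivots (lam sig : nat -> C) T : lam n.+1 = 0 -> sig n.+1 = 0 ->
  posdef_cone T ->
  beta_integrand lam sig T = \prod_(k < n) pivot_factor lam sig k (pivots T k).
Proof.
move=> lam0 sig0 pT; have p1T := posdef_add1 pT.
have tel M (mu : nat -> C) : posdef_cone M -> mu n.+1 = 0 ->
    \prod_(j < n) cpow (complex.Re (\det (upper_block j M))) (mu j.+1 - mu j.+2) =
    \prod_(j < n) cpow (pratio (lminor M j.+1) (lminor M j)) (mu j.+1).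
  move=> pM mu0; have Lpos k (kn : (k <= n)%N) := lminor_gt0 pM kn.
  rewrite -(prod_cpow_telescope (lminor0 M) Lpos mu0).
  by apply: eq_bigr => j _; rewrite -lminor_upper_block.
have detE : \det T = \prod_(k < n) ((pivots T k).1)%:C.
  have [-> _] := gt0_complexE (posdef_det_gt0 pT).
  by rewrite -lminor_det -(prod_pratio_lminor pT (leqnn n)) rmorph_prod.
have sigE := tel _ sig p1T sig0.
rewrite /beta_integrand big_split/= (tel _ lam pT lam0) detE.
under [X in _ * X * _]eq_bigr => j _ do rewrite upper_block_add1.
rewrite prodfV [X in _ * X^-1 * _]sigE -prodrXl -!prodfV -!big_split.
have factorE (s r : R) a b : 0 < s ->
    cpow s a / cpow r b * s%:C ^- n = cpow s (a - n%:R) * cpow r (- b).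
  by move=> s0; rewrite cpowB cpowN cpow_nat// rmorphXn mulrAC.
by apply: eq_bigr => k _; have [s0 _] := pivots_gt0 pT (ltn_ord k); exact: factorE s0.
Qed.

End pivot_integrand.

Section pivot_weights.
Variables (R : realType) (n : nat).
Local Notation C := R[i].
Local Notation lam := (@lebesgue_measure R).
Local Notation Rm := (measurableTypeR R).
Local Notation L := (@lebesgue_tuple R).
Local Notation Cn n := (n.-tuple Rm * n.-tuple Rm)%type.
Local Notation mC n := (prodm (L n) (L n)).
Local Notation cone n := (@hermitian_of R n @^-1` @posdef_cone R n).

Definition pivot_weight (k : nat) (z : Rm * Cn k) : R :=
  pos z.1 * `|(pivot_point z).1 * (pivot_point z).2| ^+ (n - k.+1).

(** The weight contributes n - k - 1 to both exponents. *)
Lemma pivot_weight_factor (la si : nat -> C) (k : nat) (z : Rm * Cn k) : (k < n)%N ->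
  (pivot_weight z)%:C * pivot_factor n la si k (pivot_point z) =
  pivot_power (la k.+1 - k.+1%:R + 1) (si k.+1 - n%:R + k.+1%:R) z.
Proof.
move=> kn; rewrite /pivot_weight /pivot_power /pivot_factor /pivot_point /=.
have [s0|s0] := pselect (0 < z.1); last by rewrite (pos_le0 s0) !mul0r.
have r0 : 0 < 1 + z.1 + nsq z.2.
  by rewrite ltr_pwDl ?addr_gt0// /nsq sumr_ge0// => i _; rewrite addr_ge0 ?sqr_ge0.
rewrite (pos_gt0 s0) !mul1r norm_expr_cpow// natrB//.
by congr (cpow _ _ * cpow _ _); ring.
Qed.

(** The complex form of [integral_pivot_product]. *)
Lemma cintegral_pivots (phi : 'I_n -> Rm * Rm -> C) : (forall k, cmeasurable (phi k)) ->
  (forall k : 'I_n, cintegrable (prodm lam (mC k)) setT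
     (fun z => (pivot_weight z)%:C * phi k (pivot_point z))) ->
  let F x := (\1_(cone n) x : R)%:C * \prod_(k < n) phi k (pivots (hermitian_of x) k) in
  cintegrable (L (n * n)) setT F /\
  cintegral (L (n * n)) setT F =
  \prod_(k < n) cintegral (prodm lam (mC k)) setT
     (fun z => (pivot_weight z)%:C * phi k (pivot_point z)).
Proof.
move=> mphi iphi F.
have [] := @cintegral_prod R _ ((n * n).-tuple Rm) (L (n * n)) _ (Rm * Rm)%type n _
  (fun k => Rm * Cn k)%type (fun k => prodm lam (mC k))
  (fun k x => pivots (hermitian_of x) k) (fun k => @pivot_point R k)
  (\1_(cone n)) (fun k => @pivot_weight k) 1 _ _ _ _ _ phi mphi iphi.
- by move=> k; exact: measurable_pivots.
- by apply: measurable_indic; exact: measurable_cone.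
- by move=> x; rewrite indicE.
- by move=> k z; rewrite mulr_ge0 ?pos_ge0.
- move=> psi mpsi psi0; rewrite mul1e.
  pose ext (k : nat) (y : Rm * Rm) : R := if insub k is Some i then psi i y else 0.
  have extE (i : 'I_n) : ext i = psi i by rewrite /ext valK.
  have mext k : measurable_fun setT (ext k).
    by rewrite /ext; case: insub => [i|]; [exact: mpsi|exact: measurable_cst].
  have ext0 k y : 0 <= ext k y by rewrite /ext; case: insub.
  transitivity (\int[L (n * n)]_x (@pivot_product R n ext x)%:E)%E.
    apply: eq_integral => x _; rewrite /pivot_product; congr (_ * _)%:E.
    by apply: eq_bigr => k _; rewrite extE.
  rewrite integral_pivot_product//; apply: eq_bigr => k _; rewrite extE.
  by apply: eq_integral => z _; rewrite mulrA.
by rewrite mul1r.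
Qed.

End pivot_weights.

Theorem mainTheorem2 (R : realType) (n : nat) (lam sig : nat -> R[i])
  (n_ge1 : (1 <= n)%N)
  (lam_last : lam n.+1 = 0) (sig_last : sig n.+1 = 0)
  (lam_pos : forall k : nat, (1 <= k <= n)%N ->
     0 < complex.Re (lam k - k%:R + 1))
  (sig_pos : forall k : nat, (1 <= k <= n)%N ->
     0 < complex.Re (sig k - lam k - n%:R + k%:R)) :
  let D := @hermitian_of R n @^-1` @posdef_cone R n in
  let F := fun x => beta_integrand lam sig (@hermitian_of R n x) in
  cintegrable (lebesgue_tuple R (n * n)) D F /\
  cintegral (lebesgue_tuple R (n * n)) D F =
    \prod_(1 <= k < n.+1)
      ((pi ^+ k.-1)%:C *
       (cGamma (lam k - k%:R + 1) * cGamma (sig k - lam k - n%:R + k%:R)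
        / cGamma (sig k - n%:R + k%:R))).
Proof.
move=> D F.
pose phi (k : 'I_n) : R * R -> R[i] := pivot_factor n lam sig k.
have FE : (fun x => (\1_D x : R)%:C * F x) =
    (fun x => (\1_D x : R)%:C * \prod_(k < n) phi k (pivots (hermitian_of x) k)).
  apply/funext => x; rewrite indicE; case: (boolP (x \in D)) => [/set_mem xD|_].
    by rewrite /F beta_integrand_pivots.
  by rewrite !mul0r.
have beta k : (k < n)%N -> cintegrable _ _ _ /\ cintegral _ _ _ = _ :=
  fun kn => @cintegral_pivot_power R k _ _ (lam_pos k.+1 kn) (sig_pos k.+1 kn).
have argE k : (lam k.+1 - k.+1%:R + 1) + (sig k.+1 - lam k.+1 - n%:R + k.+1%:R) + k%:R =
    sig k.+1 - n%:R + k.+1%:R.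
  by rewrite -natr1; ring.
have factorE (k : 'I_n) : (fun z => (pivot_weight n z)%:C * phi k (pivot_point z)) =
    @pivot_power R k (lam k.+1 - k.+1%:R + 1) (sig k.+1 - n%:R + k.+1%:R).
  by apply/funext => z; rewrite pivot_weight_factor.
have mphi k : cmeasurable (phi k : measurableTypeR R * measurableTypeR R -> _).
  by apply: cmeasurableM; apply: cmeasurable_cpow; mproj.
have [|iF eF] := cintegral_pivots mphi.
  by move=> k; rewrite factorE -argE; have [] := beta k (ltn_ord k).
split.
  by apply/cintegrable_mkcond; [exact: measurable_cone|rewrite FE].
rewrite cintegral_mkcond FE eF big_add1 big_mkord; apply: eq_bigr => k _.
rewrite factorE -argE; have [_ ->] := beta k (ltn_ord k).
by rewrite argE.
Qed.
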